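(* Let $n\geq 2$ and $\delta\in[0,1)$. There is a constant $C>0$ such that for every $f\in L^2(\mathbb{R}^n)$, the solution $u$ of $$ i\frac{\partial}{\partial t}u=-\triangle u+|x|^2u\ \text{ in }\mathbb{R}^{n+1},\qquad u(x,0)=f(x), $$ satisfies $$ \int_0^{2\pi}\int_{\mathbb{R}^n}\frac{|u(x,t)|^2}{(x_1^2+x_2^2)^{\delta}}\,dx\,dt\leq C\|f\|_2^2 . $$ Consequently, for $n\geq 3$, $\delta\in[0,1)$ and pairwise distinct indices $i,j,k\in\{1,\dots,n\}$, there is a constant $C>0$ such that for all such $u$ and $f$ $$ \int_0^{2\pi}\int_{\mathbb{R}^n}\frac{|u(x,t)|^2}{(x_i^2+x_j^2+x_k^2)^{\delta}}\,dx\,dt\leq C\|f\|_2^2 . $$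
   Context: Here $x=(x_1,\dots,x_n)\in\mathbb{R}^n$, $t\in\mathbb{R}$, $\triangle$ is the Laplacian in $x$, and $\|\cdot\|_2$ is the norm of $L^2(\mathbb{R}^n)$. The solution is $u(\cdot,t)=e^{-it(-\triangle+|x|^2)}f$, that is, $u(x,t)=\sum_\alpha e^{-i(2|\alpha|+n)t}a_\alpha\Phi_\alpha(x)$ with convergence in $L^2(\mathbb{R}^n)$. The sum is over $n$-multiindices $\alpha$ of nonnegative integers, $|\alpha|=\alpha_1+\dots+\alpha_n$, $\Phi_\alpha(x)=\prod_{l=1}^n h_{\alpha_l}(x_l)$, $a_\alpha=\int_{\mathbb{R}^n}f\,\Phi_\alpha\,dx$, and $h_m(s)=\frac{(-1)^m}{(2^m m!\sqrt{\pi})^{1/2}}e^{s^2/2}\frac{d^m}{ds^m}(e^{-s^2})$ are the normalized one-dimensional Hermite functions. *)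

(* Defs.v *)
From HB Require Import structures.
From mathcomp Require Export all_boot all_order all_algebra.
From mathcomp Require Export finmap.
From mathcomp Require Export all_classical all_reals all_analysis.
From mathcomp Require Export complex summability.

Export Order.TTheory GRing.Theory Num.Theory.
Export numFieldNormedType.Exports.
Export Normc.

#[export] Set Implicit Arguments.
#[export] Unset Strict Implicit.
#[export] Unset Printing Implicit Defensive.

Local Open Scope classical_set_scope.
Local Open Scope ring_scope.
Local Open Scope complex_scope.

Section lebesgue_tuple.
Context {R : realType}.

(* R^n is [n.-tuple R] with the product (Borel) sigma-algebra. Its Lebesgue
   measure is the n-fold product of the one on R, transported along
   (x_1, (x_2, ..., x_n)) |-> (x_1, ..., x_n). *)
Definition tcons n (p : measurableTypeR R * n.-tuple R) : n.+1.-tuple R :=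
  [tuple of p.1 :: p.2].

Lemma measurable_tcons n : measurable_fun setT (@tcons n).
Proof.
exact: (@measurable_cons _ _ _ R fst n snd measurable_fst measurable_snd).
Qed.

Definition lebesgue_tcons n (mu : {sigma_finite_measure set (n.-tuple R) -> \bar R})
    : set (n.+1.-tuple R) -> \bar R :=
  pushforward (lebesgue_measure \x mu)%E (@tcons n).

Section lebesgue_tcons_measure.
Context n (mu : {sigma_finite_measure set (n.-tuple R) -> \bar R}).

Let lebesgue_tcons0 : lebesgue_tcons mu set0 = 0%E.
Proof. by rewrite /lebesgue_tcons /pushforward preimage_set0 measure0. Qed.

Let lebesgue_tcons_ge0 A : (0 <= lebesgue_tcons mu A)%E.
Proof. exact: (measure_ge0 (lebesgue_measure \x mu)%E). Qed.

Let lebesgue_tcons_sigma_additive : semi_sigma_additive (lebesgue_tcons mu).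
Proof.
move=> F mF tF mUF; rewrite /lebesgue_tcons /pushforward preimage_bigcup.
have mtcons A : measurable A -> measurable (@tcons n @^-1` A).
  by move=> mA; rewrite -[X in measurable X]setTI; exact: measurable_tcons.
apply: (@measure_semi_sigma_additive _ _ _ (lebesgue_measure \x mu)%E).
- by move=> k; exact: mtcons.
- apply/trivIsetP => /= i j _ _ ij; rewrite -preimage_setI.
  by move/trivIsetP : tF => /(_ _ _ _ _ ij) ->//; rewrite preimage_set0.
- by rewrite -preimage_bigcup; exact: mtcons.
Qed.

HB.instance Definition _ := isMeasure.Build _ _ _ (lebesgue_tcons mu)
  lebesgue_tcons0 lebesgue_tcons_ge0 lebesgue_tcons_sigma_additive.

Let lebesgue_tcons_sigma_finite : sigma_finite setT (lebesgue_tcons mu).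
Proof.
have /sigma_finiteP[F [TF ndF Foo]] := @sigma_finiteT _ _ _ (@lebesgue_measure R).
have /sigma_finiteP[G [TG ndG Goo]] := sigma_finiteT mu.
pose g (x : n.+1.-tuple R) : measurableTypeR R * n.-tuple R :=
  (tnth x ord0, [tuple of behead x]).
have tK : cancel (@tcons n) g.
  by move=> [a x]; congr (_, _); apply/val_inj.
have mg : measurable_fun setT g.
  apply/measurable_fun_pairP; split; first exact: measurable_tnth.
  exact: measurable_behead.
exists (fun k => g @^-1` (F k `*` G k)).
  rewrite predeqE => x; split => // _.
  have [k _ Fk] : (\bigcup_k F k) (g x).1 by rewrite -TF.
  have [l _ Gl] : (\bigcup_k G k) (g x).2 by rewrite -TG.
  exists (maxn k l) => //; split.
  - by move: Fk; exact/subsetPset/ndF/leq_maxl.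
  - by move: Gl; exact/subsetPset/ndG/leq_maxr.
move=> k; have [mF Fk] := Foo k; have [mG Gk] := Goo k; split.
  by rewrite -[X in measurable X]setTI; apply: mg => //; exact: measurableX.
rewrite /lebesgue_tcons /pushforward -comp_preimage.
rewrite (_ : g \o @tcons n = id) ?preimage_id; last exact/funext.
by rewrite product_measure1E// lte_mul_pinfty// ge0_fin_numE.
Qed.

HB.instance Definition _ := Measure_isSigmaFinite.Build _ _ _
  (lebesgue_tcons mu) lebesgue_tcons_sigma_finite.

End lebesgue_tcons_measure.

Fixpoint lebesgue_tuple n : {sigma_finite_measure set (n.-tuple R) -> \bar R} :=
  match n with
  | 0 => @dirac _ (0.-tuple R) [tuple] R
  | n'.+1 => lebesgue_tcons (lebesgue_tuple n')
  end.

End lebesgue_tuple.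

Section complex_L2.
Context d {T : measurableType d} {R : realType}.
Variable mu : {measure set T -> \bar R}.
Implicit Types f g : T -> R[i].

Definition normL2 f : \bar R := Lnorm mu 2%:E (fun x => (normc (f x))%:E).

Definition inL2 f : Prop :=
  [/\ measurable_fun setT (fun x => complex.Re (f x)),
      measurable_fun setT (fun x => complex.Im (f x)) &
      (normL2 f < +oo)%E].

Definition Cintegral f : R[i] :=
  (\int[mu]_x complex.Re (f x)) +i* (\int[mu]_x complex.Im (f x)).

(* g = \sum_i F i, unconditionally, in L^2(mu): the finite partial sums converge
   along the net of finite index sets. *)
Definition sumL2 (I : choiceType) (F : I -> T -> R[i]) g : Prop :=
  inL2 g /\
  (fun A : {fset I} => normL2 (fun x => g x - \sum_(a <- A) F a x))
    @ totally --> 0%E.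

End complex_L2.

Section harmonic_oscillator.
Context {R : realType}.

Definition hermite (m : nat) (s : R) : R :=
  (-1) ^+ m / Num.sqrt (2 ^+ m * m`!%:R * Num.sqrt pi)
  * expR (s ^+ 2 / 2) * derive1n m (fun r : R => expR (- r ^+ 2)) s.

Definition hermite_tuple n (alpha : n.-tuple nat) (x : n.-tuple R) : R :=
  \prod_(l < n) hermite (tnth alpha l) (tnth x l).

Definition multi_abs n (alpha : n.-tuple nat) : nat :=
  (\sum_(l < n) tnth alpha l)%N.

Definition hermite_coef n (f : n.-tuple R -> R[i]) (alpha : n.-tuple nat) : R[i] :=
  Cintegral (lebesgue_tuple n) (fun x => f x * (hermite_tuple alpha x)%:C).

Definition cexpi (theta : R) : R[i] := cos theta +i* sin theta.

(* u(., t) = e^{-it(-Delta + |x|^2)} f for every real t. Each u(., t) is only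
   determined up to a null set. *)
Definition oscillator_solution n (f : n.-tuple R -> R[i])
    (u : n.-tuple R -> R -> R[i]) : Prop :=
  forall t : R,
    sumL2 (lebesgue_tuple n)
      (fun (alpha : n.-tuple nat) x =>
         cexpi (- ((2 * multi_abs alpha + n)%N%:R * t))
         * hermite_coef f alpha * (hermite_tuple alpha x)%:C)
      (fun x => u x t).

(* \int_0^{2 pi} \int_{R^n} |u(x, t)|^2 / w(x)^delta dx dt. The quotient is 0
   where w vanishes and delta != 0, which for the weights of interest is
   a null set. *)
Definition weighted_integral n (u : n.-tuple R -> R -> R[i])
    (w : n.-tuple R -> R) (delta : R) : \bar R :=
  (\int[lebesgue_measure]_(t in `[0%R, (2 * pi)%R])
     \int[lebesgue_tuple n]_x (normc (u x t) ^+ 2 / w x `^ delta)%:E)%E.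

End harmonic_oscillator.

(* Main.v *)
(* By orthogonality of the exponentials e^(-i(2N+n)t) on [0, 2 pi], the time
   integral only sees pairs of multiindices with the same degree N. Hence one
   needs, for |x_i|, |x_j| <= 1/2 and a fixed value S = alpha_i + alpha_j (the
   other indices being separated by orthonormality), a bound on
   sum_(a + b = S) h_a(x_i)^2 h_b(x_j)^2 which is uniform in S. The energy
   h'^2 + (2m + 1 - s^2) h^2 of h = h_m is maximal at s = 0, which gives
   h_m(s)^2 <= 8 / sqrt(m + 1) for |s| <= 1/2, and
   sum_(a + b = S) 1 / sqrt((a + 1)(b + 1)) <= 4. As
   (x_i^2 + x_j^2)^(-delta) <= |x_i|^(-delta) |x_j|^(-delta) is integrable on the
   square and bounded off it, the inequality follows for finite sums; Fatou's
   lemma and Bessel's inequality give the general case. The argument works for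
   any two coordinates and any larger weight, which covers the three-coordinate
   inequality. *)

Require Import Defs.
From mathcomp Require Import ring lra measurable_realfun.

Local Open Scope classical_set_scope.
Local Open Scope ring_scope.

(** * Hermite polynomials and a local bound on Hermite functions *)

Section hermite_poly.
Context {R : realType}.

(** Two obstacles shape the limit passage. Each [u(., t)] is fixed only up to a null set, separately
    for every [t], so [u x t] need not be measurable in [t], and Fatou's lemma in time cannot be
    applied to [u] itself. For fixed [t] the inner integral is therefore bounded by a lower limit of
    the same integrals for finite sums, which are trigonometric polynomials in [t]; only this
    measurable majorant is integrated by Fatou. Moreover, convergence in L^2 says nothing about an
    unbounded weight. The weight is replaced by a bounded one depending on [e > 0], with a final
    constant independent of [e], and [e] tends to 0 in a second application of Fatou. For the
    bounded weight the inequality [|u|^2 <= 2 |v|^2 + 2 |u - v|^2] suffices: it costs a factor 2 but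
    avoids extracting subsequences that converge almost everywhere. *)

Fixpoint hermite_poly (m : nat) : {poly R} :=
  if m is k.+1 then 2%:P * 'X * hermite_poly k - (hermite_poly k)^`() else 1.

Lemma deriv_hermite_poly m :
  (hermite_poly m.+1)^`() = (2 * m.+1%:R)%:P * hermite_poly m.
Proof.
elim: m => [|m IH]; first by rewrite /= !poly.derivE; ring.
have -> : hermite_poly m.+2 =
  2%:P * 'X * hermite_poly m.+1 - (hermite_poly m.+1)^`() by [].
rewrite derivB !derivM !derivC derivX IH !derivM !derivC -[m.+2%:R]natr1.
rewrite [hermite_poly m.+1]/=; set k := m.+1%:R.
by rewrite !(polyCM, polyCD) polyC1; ring.
Qed.

Lemma hermite_polyS m :
  hermite_poly m.+2 =
  2%:P * 'X * hermite_poly m.+1 - (2 * m.+1%:R)%:P * hermite_poly m.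
Proof. by rewrite -deriv_hermite_poly. Qed.

Lemma size_hermite_poly m : (size (hermite_poly m) <= m.+1)%N.
Proof.
elim: m => [|m IH]; first by rewrite size_poly1.
rewrite /= (leq_trans (size_polyD _ _))// geq_max size_polyN; apply/andP; split.
  rewrite -mulrA mul_polyC (leq_trans (size_scale_leq _ _))// mulrC.
  by rewrite (leq_trans (size_polyMleq _ _))// size_polyX addn2.
by rewrite polyorder.size_deriv (leq_trans (leq_pred _))// (leq_trans IH).
Qed.

Lemma derivn_hermite_poly m : (hermite_poly m)^`(m) = (2 ^+ m * m`!%:R)%:P.
Proof.
elim: m => [|m IH]; first by rewrite derivn0 expr0 mul1r fact0.
rewrite derivSn deriv_hermite_poly mul_polyC derivnZ IH -mul_polyC -polyCM.
by congr polyC; rewrite factS natrM exprS; set k := m.+1%:R; ring.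
Qed.

Lemma hermite_ode m : (hermite_poly m)^`()^`() =
  2%:P * 'X * (hermite_poly m)^`() - (2 * m%:R)%:P * hermite_poly m.
Proof.
case: m => [|m]; first by rewrite /= !poly.derivE mulr0; ring.
rewrite deriv_hermite_poly derivM derivC mul0r add0r [in RHS]/=.
by ring.
Qed.

Lemma is_derive_horner (p : {poly R}) (s : R) :
  is_derive s 1 (horner p) (p^`()).[s].
Proof. exact: is_derive_poly. Qed.

Lemma is_derive_gauss (s : R) :
  is_derive s 1 (fun r : R => expR (- r ^+ 2)) (- (2 * s) * expR (- s ^+ 2)).
Proof.
apply: is_derive_eq; rewrite /GRing.scale /= ?expr1; ring.
Qed.

(** This class is stable under differentiation and contains, up to constants, all products of two
    Hermite functions, so that analytic statements about them become polynomial identities. *)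
Definition pgauss (p : {poly R}) (s : R) : R := p.[s] * expR (- s ^+ 2).

Lemma is_derive_pgauss p (s : R) :
  is_derive s 1 (pgauss p) (pgauss (p^`() - 2%:P * 'X * p) s).
Proof.
have h1 := is_derive_horner p s; have h2 := is_derive_gauss s.
apply: is_derive_eq; rewrite /pgauss !hornerE /GRing.scale /=; ring.
Qed.

(** Rodrigues' formula: differentiating [H exp(-s^2)] gives [-(2 s H - H') exp(-s^2)], which is the
    recursion defining [hermite_poly] up to sign. *)
Lemma derive1n_gauss m :
  derive1n m (fun r : R => expR (- r ^+ 2)) = pgauss ((-1) ^+ m *: hermite_poly m).
Proof.
elim: m => [|m IH].
  by apply/funext => s; rewrite derive1n0 /pgauss expr0 scale1r hornerE mul1r.
rewrite derive1nS IH; apply/funext => s; rewrite derive1E.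
have h := is_derive_pgauss ((-1) ^+ m *: hermite_poly m) s.
rewrite derive_val; congr pgauss.
rewrite derivZ /= exprS -!mul_polyC !polyCM; ring.
Qed.

Definition hermite_norm m : R := 2 ^+ m * m`!%:R * Num.sqrt pi.

Lemma hermite_norm_gt0 m : 0 < hermite_norm m.
Proof. by rewrite !mulr_gt0 ?exprn_gt0 ?ltr0n ?fact_gt0 ?sqrtr_gt0 ?pi_gt0. Qed.

Lemma hermiteE m (s : R) : hermite m s =
  (hermite_poly m).[s] * expR (- (s ^+ 2 / 2)) / Num.sqrt (hermite_norm m).
Proof.
rewrite /hermite derive1n_gauss /pgauss hornerZ -/(hermite_norm m).
rewrite (_ : - s ^+ 2 = - (s ^+ 2 / 2) + - (s ^+ 2 / 2)); last by field.
rewrite expRD [expR (- _)]expRN.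
have h1 : expR (s ^+ 2 / 2) != 0 by rewrite gt_eqF// expR_gt0.
have h2 : Num.sqrt (hermite_norm m) != 0.
  by rewrite gt_eqF// sqrtr_gt0 hermite_norm_gt0.
have := sqrr_sign R m; set e := (-1) ^+ m => e1.
set E := expR _ in h1 *; set S := Num.sqrt _ in h2 *; set H := (hermite_poly m).[s].
have -> : e / S * E * (e * H * (E^-1 / E)) = e ^+ 2 * (H / E) / S.
  by field; rewrite h1 h2.
by rewrite e1 mul1r.
Qed.

Lemma hermiteM a b (s : R) : hermite a s * hermite b s =
  pgauss (hermite_poly a * hermite_poly b) s
    / (Num.sqrt (hermite_norm a) * Num.sqrt (hermite_norm b)).
Proof.
rewrite !hermiteE /pgauss hornerM.
rewrite (_ : - s ^+ 2 = - (s ^+ 2 / 2) + - (s ^+ 2 / 2)); last by field.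
rewrite expRD; field.
by rewrite !gt_eqF// ?sqrtr_gt0 ?hermite_norm_gt0.
Qed.

Lemma hermite_sqr a (s : R) : hermite a s ^+ 2 =
  pgauss (hermite_poly a ^+ 2) s / hermite_norm a.
Proof.
rewrite !expr2 hermiteM -[in RHS](@sqr_sqrtr _ (hermite_norm a)) ?expr2//.
by rewrite ltW// hermite_norm_gt0.
Qed.

(* With h = hermite m, [energy_poly m] times the Gaussian is, up to
   normalization, the energy h' ^ 2 + (2 m + 1 - s ^ 2) h ^ 2 of the Hermite
   equation h'' = (s ^ 2 - 2 m - 1) h; its derivative is - 2 s h ^ 2. *)
Definition energy_poly m : {poly R} :=
  (hermite_poly m)^`() ^+ 2 - 2%:P * 'X * hermite_poly m * (hermite_poly m)^`()
  + (2 * m%:R + 1)%:P * hermite_poly m ^+ 2.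

Lemma energy_deriv m : (energy_poly m)^`() - 2%:P * 'X * energy_poly m =
  - (2%:P * 'X * hermite_poly m ^+ 2).
Proof.
rewrite /energy_poly !(derivB, derivD, derivM, expr2, derivC, derivX).
rewrite !hermite_ode; set H' := (hermite_poly m)^`(); set H := hermite_poly m.
rewrite polyCD polyCM; ring.
Qed.

(** The derivative has the sign of [-s], so the mean value theorem between 0 and [s] gives the bound
    on either side. *)
Lemma energy_le0 m (s : R) : pgauss (energy_poly m) s <= pgauss (energy_poly m) 0.
Proof.
have dE (x : R) : is_derive x 1 (pgauss (energy_poly m))
    (- (2 * x * (hermite_poly m).[x] ^+ 2) * expR (- x ^+ 2)).
  apply: (is_derive_eq (is_derive_pgauss (energy_poly m) x)).
  by rewrite energy_deriv /pgauss !hornerE.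
have c (x : R) : {for x, continuous (pgauss (energy_poly m))}.
  by apply: differentiable_continuous; apply/derivable1_diffP; have [] := dE x.
have [s0|s0] := leP 0 s.
- have [|x xs e] := MVT_segment s0 (fun x _ => dE x).
  + by apply: continuous_in_subspaceT => x _; exact: c.
  + rewrite -subr_le0 e mulNr mulNr oppr_le0 mulr_ge0 ?subr0//.
    by rewrite mulr_ge0 ?expR_ge0// mulr_ge0 ?sqr_ge0// mulr_ge0// (itvP xs).
- have [|x xs e] := MVT_segment (ltW s0) (fun x _ => dE x).
  + by apply: continuous_in_subspaceT => x _; exact: c.
  + rewrite -subr_ge0 e mulr_ge0 ?sub0r ?oppr_ge0 ?(ltW s0)//.
    rewrite mulr_ge0 ?expR_ge0// oppr_ge0 mulr_le0_ge0 ?sqr_ge0//.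
    by rewrite mulr_ge0_le0// (itvP xs).
Qed.

Lemma hermite_normS m : hermite_norm m.+1 = 2 * m.+1%:R * hermite_norm m.
Proof. by rewrite /hermite_norm factS natrM exprS; set k := m.+1%:R; ring. Qed.

(** Induction in steps of two, as [H_(m+2)(0) = -2 (m + 1) H_m(0)]; odd polynomials vanish at 0, and
    [m = 0] is [1 <= sqrt pi]. With [x = m + 1] the step reduces to
    [x sqrt(x + 2) <= (x + 1) sqrt x], that is, to [x (x + 2) <= (x + 1)^2]. *)
Lemma hermite_poly_sqr0 m :
  (hermite_poly m).[0] ^+ 2 <= hermite_norm m / Num.sqrt m.+1%:R.
Proof.
have [k] := ubnP m; elim: k m => // k IH [_|[_|m]].
- rewrite /hermite_norm hornerE sqrtr1 divr1 !expr0 fact0 expr1n !mul1r.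
  by rewrite -[leLHS]sqrtr1 ler_wsqrtr// (le_trans _ (pi_ge2 _))// ler1n.
- rewrite hermite_normS [hermite_poly 1]/= mulr1 poly.derivE subr0.
  rewrite !hornerE ?mulr0 expr0n/=.
  by rewrite divr_ge0 ?sqrtr_ge0// mulr_ge0// ltW// hermite_norm_gt0.
- rewrite !ltnS => mk; have {IH} := IH m (ltnW mk).
  rewrite hermite_polyS !hermite_normS.
  move: (hermite_norm m) (hermite_norm_gt0 m) => N N0 hN.
  rewrite !hornerE/= ?(mulr0, mul0r, add0r, sub0r) sqrrN exprMn; move: hN.
  set h := (hermite_poly m).[0] => hN.
  apply: le_trans (ler_wpM2l (sqr_ge0 _) hN) _.
  set x : R := m.+1%:R; set y := Num.sqrt x; set z := Num.sqrt _.
  have x0 : 0 < x by rewrite ltr0n.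
  have -> : m.+2%:R = x + 1 :> R by rewrite natr1.
  have y0 : 0 < y by rewrite sqrtr_gt0.
  have z0 : 0 < z by rewrite sqrtr_gt0.
  have yx : y ^+ 2 = x by rewrite sqr_sqrtr// ltW.
  have zx : z ^+ 2 = x + 2 by rewrite sqr_sqrtr// -natrD addn2.
  have xz : x * z <= (x + 1) * y.
    rewrite -ler_sqr ?nnegrE; last 2 first.
    - by rewrite mulr_ge0// ltW.
    - by rewrite mulr_ge0 ?addr_ge0// ltW.
    by rewrite !exprMn zx yx; nra.
  have -> : (2 * x) ^+ 2 * (N / y) = 4 * x * N * (x / y) by ring.
  have -> : 2 * (x + 1) * 2 * x * N / z = 4 * x * N * ((x + 1) / z) by ring.
  rewrite ler_pM2l; last by rewrite !mulr_gt0.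
  by rewrite ler_pdivrMr// mulrAC ler_pdivlMr.
Qed.

Lemma hermite_local_bound m (s : R) : s ^+ 2 <= 4^-1 ->
  hermite m s ^+ 2 <= 8 / Num.sqrt m.+1%:R.
Proof.
move=> s4; have := energy_le0 m s.
rewrite {2}/pgauss /energy_poly !hornerE/= ?(mulr0, mul0r, subr0, expr0n)/=.
rewrite ?(oppr0, expR0, mulr1).
have -> : (hermite_poly m)^`().[0] = - (hermite_poly m.+1).[0].
  by rewrite /= !hornerE ?(mulr0, mul0r, sub0r) opprK.
rewrite sqrrN => e0.
have := hermite_poly_sqr0 m; have := hermite_poly_sqr0 m.+1.
rewrite hermite_sqr hermite_normS.
move: (hermite_norm m) (hermite_norm_gt0 m) => N N0.
move: e0; rewrite /pgauss; move: (hermite_poly m.+1).[0] => g.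
rewrite !hornerE.
set h := (hermite_poly m).[0].
set H := (hermite_poly m).[s]; set H' := (hermite_poly m)^`().[s].
set e := expR _ => e0 gle hle.
have ege0 : 0 < e by exact: expR_gt0.
have x0 : 0 < m.+1%:R :> R by rewrite ltr0n.
rewrite -natr1 in x0 gle hle *; set x := m%:R + 1 in x0 gle hle *.
set y := Num.sqrt x in hle *; have y0 : 0 < y by rewrite sqrtr_gt0.
have {}gle : g ^+ 2 <= 2 * x * (N / y).
  apply: (le_trans gle); rewrite -mulrA ler_pM2l ?mulr_gt0//.
  rewrite ler_pM2l// lef_pV2 ?posrE ?sqrtr_gt0 ?ltr0n// ler_wsqrtr//.
  by rewrite -natr1 -natr1 /x lerDl.
rewrite ler_pdivrMr// [leRHS]mulrAC -[leRHS]mulrA; set Q := N / y in gle hle *.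
(* Completing the square, the energy at [s] is [(H' - s H)^2 + (2 m + 1 - s^2) H^2] times the
   Gaussian, and [2 m + 1 - s^2 >= x / 2] for [s^2 <= 1/4]. At 0 it is
   [g^2 + (2 m + 1) h^2 <= 2 x Q + 2 x Q], which is [(x / 2) (8 Q)]: hence the constant 8. *)
have {}e0 : (x / 2) * (H ^+ 2 * e) <= (x / 2) * (8 * Q).
  apply: (@le_trans _ _ ((H' ^+ 2 - 2 * s * H * H' + (2 * m%:R + 1) * H * H) * e)).
    rewrite mulrA ler_pM2r//.
    have : 0 <= (H' - s * H) ^+ 2 by exact: sqr_ge0.
    have : x / 2 * H ^+ 2 <= (2 * m%:R + 1 - s ^+ 2) * H ^+ 2.
      rewrite ler_wpM2r ?sqr_ge0// /x.
      have : 0 <= m%:R :> R by [].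
      lra.
    lra.
  apply: (le_trans e0).
  have : (2 * m%:R + 1) * (h ^+ 2) <= (2 * x) * Q.
    apply: ler_pM => //; rewrite ?sqr_ge0//.
    by rewrite /x; have : 0 <= m%:R :> R by []; lra.
  have : 0 <= x * Q by rewrite !mulr_ge0// ?invr_ge0 ltW.
  lra.
by move: e0; rewrite ler_pM2l ?divr_gt0 // expr2 mulrAC mulrA.
Qed.
End hermite_poly.

(** * Gaussian integrals and orthonormality *)

Section gauss.
Context {R : realType}.
Let mu : {measure set _ -> \bar R} := @lebesgue_measure R.

Lemma is_derive_continuous (F f : R -> R) :
  (forall x : R, is_derive x 1 F (f x)) -> continuous F.
Proof.
move=> dF x; apply: differentiable_continuous; apply/derivable1_diffP.
by have [] := dF x.
Qed.

Lemma integral_is_derive (F f : R -> R) (a b : R) : a < b ->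
  (forall x : R, is_derive x 1 F (f x)) -> continuous f ->
  (\int[mu]_(x in `[a, b]) (f x)%:E = (F b - F a)%:E)%E.
Proof.
move=> ab dF cf; rewrite EFinB; apply: continuous_FTC2 => //.
- exact: continuous_subspaceT.
- have cF := is_derive_continuous dF; split => [x _| |].
  + by have [] := dF x.
  + by apply: cvg_at_right_filter; exact: cF.
  + by apply: cvg_at_left_filter; exact: cF.
- by move=> x _; rewrite derive1E; have d := dF x; rewrite derive_val.
Qed.

Lemma integrable_expR_sqr :
  mu.-integrable setT (EFin \o (fun s : R => expR (- (s ^+ 2 / 2)))).
Proof.
have := @integrable_normal_pdf R 0 1.
rewrite -/mu => /(integrableZl measurableT (normal_peak (1:R))^-1) h.
apply: eq_integrable h => // x _ /=.
rewrite normal_pdfE ?oner_neq0// -EFinM mulKf; last first.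
  by rewrite gt_eqF// normal_peak_gt0// oner_neq0.
by rewrite /normal_fun subr0 expr1n mulNr.
Qed.

(** For monomials, [|s|^k <= 1 + s^(2k)], and [s^(2k) / (2^k k!)] is a term of the exponential
    series at [s^2 / 2]. The 1 added to [C] keeps it positive when [p = 0]. *)
Lemma horner_le_expR (p : {poly R}) : exists2 C : R, 0 < C &
  forall s, `|p.[s]| <= C * expR (s ^+ 2 / 2).
Proof.
have pow k (s : R) : `|s ^+ k| <= (1 + 2 ^+ k * k`!%:R) * expR (s ^+ 2 / 2).
  have e1 : 1 <= expR (s ^+ 2 / 2).
    by rewrite -expR0 ler_expR divr_ge0 ?sqr_ge0.
  apply: (@le_trans _ _ (1 + (s ^+ 2) ^+ k)).
    rewrite exprAC normrX; have : 0 <= (`|s ^+ k| - 1) ^+ 2 by exact: sqr_ge0.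
    rewrite -(real_normK (num_real (s ^+ k))) normrX.
    set x := `|s| ^+ k; have : 0 <= x by rewrite exprn_ge0.
    nra.
  rewrite mulrDl mul1r lerD//; case: k => [|k].
    by rewrite !expr0 fact0 !mul1r.
  have h := @expR_ge1Dxn _ (s ^+ 2 / 2) k (divr_ge0 (sqr_ge0 s) (ler0n _ 2)).
  have K0 : 0 < 2 ^+ k.+1 * k.+1`!%:R :> R.
    by rewrite mulr_gt0 ?exprn_gt0 ?ltr0n ?fact_gt0.
  rewrite -ler_pdivrMl// (le_trans _ h)// expr_div_n invfM mulrC mulrA.
  by rewrite lerDr.
exists (1 + \sum_(i < size p) `|p`_i| * (1 + 2 ^+ i * i`!%:R)).
  rewrite ltr_pwDl// sumr_ge0// => i _; rewrite mulr_ge0//.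
  move=> s; rewrite horner_coef (le_trans (ler_norm_sum _ _ _))// mulrDl mulr_suml.
rewrite ler_wpDl ?mul1r ?expR_ge0// ler_sum// => i _.
by rewrite normrM -mulrA ler_wpM2l.
Qed.

Lemma pgauss_le (p : {poly R}) : exists2 C : R, 0 < C &
  forall s, `|pgauss p s| <= C * expR (- (s ^+ 2 / 2)).
Proof.
have [C C0 hC] := horner_le_expR p; exists C => // s.
rewrite /pgauss normrM (ger0_norm (expR_ge0 _)).
rewrite [X in expR X](_ : _ = - (s ^+ 2 / 2) + - (s ^+ 2 / 2)); last by field.
rewrite expRD mulrA ler_wpM2r ?expR_ge0// expRN ler_pdivrMr ?expR_gt0//.
Qed.

Lemma continuous_pgauss (p : {poly R}) : continuous (pgauss p).
Proof. exact: is_derive_continuous (is_derive_pgauss p). Qed.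

Lemma integrable_pgauss (p : {poly R}) : mu.-integrable setT (EFin \o pgauss p).
Proof.
have [C C0 hC] := pgauss_le p.
apply: (le_integrable _ _ _ (integrableZl measurableT C integrable_expR_sqr)) => //.
  apply/measurable_EFinP; apply: continuous_measurable_fun.
  exact: continuous_pgauss.
move=> x _ /=; rewrite lee_fin (le_trans (hC x))//.
exact: ler_norm.
Qed.

(** The integrand is the derivative of [pgauss p], which vanishes at infinity: its integrals over
    [[-N, N]] are boundary terms of size at most [2 C / N], and dominated convergence lets [N]
    grow. *)
Lemma integral_deriv_pgauss (p : {poly R}) :
  \int[mu]_s pgauss (p^`() - 2%:P * 'X * p) s = 0.
Proof.
set q := _ - _; have iq := integrable_pgauss q.
have [C C0 hC] := pgauss_le p.
pose f_ (n : nat) : R -> \bar R := (EFin \o pgauss q) \_ `[- n.+1%:R, n.+1%:R].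
have [|||||_ _ h] := @dominated_convergence _ _ _ mu setT measurableT f_
   (EFin \o pgauss q) (abse \o (EFin \o pgauss q)).
- move=> n; apply/(measurable_restrictT _ _).1 => //; apply: measurable_funTS.
  by have /integrableP[] := iq.
- by have /integrableP[] := iq.
- apply: aeW => x _; apply: cvg_near_cst; near=> n.
  rewrite /f_ patchE mem_set//= in_itv/= -ler_norml.
  have : (Num.bound `|x| <= n)%N by near: n; exact: nbhs_infty_ge.
  rewrite -(ler_nat R) => h; rewrite ltW// (lt_trans (archi_boundP (normr_ge0 x)))//.
  by rewrite (le_lt_trans h)// ltr_nat.
- exact: integrable_abse.
- apply: aeW => x n _; rewrite /f_ patchE; case: ifP => // _.
  by rewrite [point](_ : _ = 0%E)// abse0 /= lee_fin.
have h0 : (fun n : nat => \int[mu]_x f_ n x)%E @ \oo --> 0%E.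
  have -> : (fun n : nat => \int[mu]_x f_ n x)%E =
      EFin \o (fun n => pgauss p n.+1%:R - pgauss p (- n.+1%:R)).
    apply/funext => n /=; rewrite /f_ -integral_mkcond.
    apply: integral_is_derive; last exact: continuous_pgauss.
    - by rewrite gtrN.
    - exact: is_derive_pgauss.
  apply: cvg_EFin; first exact: nearW.
  apply: (@squeeze_cvgr _ _ _ _
    (fun n => - (2 * C * harmonic n)) (fun n => 2 * C * harmonic n)).
  + apply: nearW => n; rewrite -ler_norml (le_trans (ler_normB _ _))//.
    set N : R := n.+1%:R; have N0 : 0 < N by rewrite ltr0n.
    (* From [exp y >= 1 + y] and [N <= 1 + N^2 / 2]. *)
    have e1 : expR (- (N ^+ 2 / 2)) <= N^-1.
      rewrite expRN lef_pV2 ?posrE ?expR_gt0// (le_trans _ (expR_ge1Dx _))//.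
      by have := sqr_ge0 (N - 1); lra.
    have := hC N; have := hC (- N); rewrite sqrrN /harmonic/= -/N.
    have : C * expR (- (N ^+ 2 / 2)) <= C * N^-1 by rewrite ler_wpM2l// ltW.
    rewrite -mulrA.
    by move: (C * expR _) (C / N) `|pgauss p N| `|pgauss p (- N)| => *; lra.
  + rewrite -[X in _ --> X]oppr0 -(mulr0 (2 * C)); apply: cvgN.
    by apply: cvgZr; exact: cvg_harmonic.
  + rewrite -[X in _ --> X](mulr0 (2 * C)).
    by apply: cvgZr; exact: cvg_harmonic.
by rewrite /Rintegral (cvg_unique _ h h0).
Unshelve. all: by end_near.
Qed.

(** Integration by parts, one derivative at a time: the derivative of [pgauss (H_a q)] is
    [pgauss (H_a q' - H_(a+1) q)] and has integral 0. *)
Lemma integral_hermite_poly a (q : {poly R}) :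
  \int[mu]_s pgauss (hermite_poly a * q) s = \int[mu]_s pgauss (q^`(a)) s.
Proof.
elim: a q => [|a IH] q; first by rewrite derivn0 mul1r.
have := integral_deriv_pgauss (hermite_poly a * q).
have -> : (hermite_poly a * q)^`() - 2%:P * 'X * (hermite_poly a * q) =
  hermite_poly a * q^`() - hermite_poly a.+1 * q.
  by rewrite derivM /=; ring.
under eq_Rintegral do rewrite /pgauss hornerD hornerN mulrBl.
rewrite RintegralB//; try exact: integrable_pgauss.
move/eqP; rewrite subr_eq0 => /eqP <-.
by rewrite IH derivSn.
Qed.

(** By symmetry [b <= a]. Moving [a] derivatives onto [H_b] leaves the constant [2^a a!] if [a = b],
    and 0 if [b < a] by degree. *)
Lemma integral_hermiteM a b :
  \int[mu]_s (hermite a s * hermite b s) = (a == b)%:R.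
Proof.
wlog ab : a b / (b <= a)%N.
  move=> wl; have [/wl//|/ltnW/wl] := leqP b a.
  by rewrite eq_sym => <-; apply: eq_Rintegral => s _; rewrite mulrC.
under eq_Rintegral do rewrite hermiteM mulrC.
rewrite RintegralZl//; last exact: integrable_pgauss.
rewrite integral_hermite_poly.
have [<-|nab] := eqVneq.
  rewrite derivn_hermite_poly -expr2 sqr_sqrtr; last by rewrite ltW// hermite_norm_gt0.
  under eq_Rintegral do rewrite /pgauss hornerC.
  rewrite RintegralZl//; last exact: integrableT_gauss.
  rewrite /Rintegral integralT_gauss/= mulVf//.
  by rewrite gt_eqF// hermite_norm_gt0.
have -> : (@hermite_poly R b)^`(a) = 0.
  apply: derivn_poly0; rewrite (leq_trans (size_hermite_poly _))// ltn_neqAle ab.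
  by rewrite eq_sym nab.
under eq_Rintegral do rewrite /pgauss horner0 mul0r.
by rewrite Rintegral_cst// mul0r mulr0.
Qed.

Lemma integrable_hermiteM a b :
  mu.-integrable setT (EFin \o (fun s => hermite a s * hermite b s)).
Proof.
have := integrable_pgauss (hermite_poly a * hermite_poly b).
move=> /(integrableZl measurableT
  (Num.sqrt (hermite_norm a) * Num.sqrt (hermite_norm b))^-1) h.
by apply: eq_integrable h => // x _ /=; rewrite hermiteM -EFinM mulrC.
Qed.

Lemma continuous_hermite a : continuous (@hermite R a).
Proof.
have -> : @hermite R a = fun s =>
    (hermite_poly a).[s] * expR (- (s ^+ 2 / 2)) / Num.sqrt (hermite_norm a).
  by apply/funext => s; rewrite hermiteE.
exact: is_derive_continuous.
Qed.

End gauss.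

(** * Integrals of products of one-variable functions *)

Section product_integral.
Context d1 d2 (T1 : measurableType d1) (T2 : measurableType d2) (R : realType).
Variables (m1 : {sigma_finite_measure set T1 -> \bar R}).
Variables (m2 : {sigma_finite_measure set T2 -> \bar R}).
Variables (f : T1 -> R) (g : T2 -> R).
Hypothesis if1 : m1.-integrable setT (EFin \o f).
Hypothesis ig2 : m2.-integrable setT (EFin \o g).

Let mf : measurable_fun setT f.
Proof. by apply/measurable_EFinP; exact: measurable_int if1. Qed.

Let mg : measurable_fun setT g.
Proof. by apply/measurable_EFinP; exact: measurable_int ig2. Qed.

Let mfg : measurable_fun setT (EFin \o (fun z : T1 * T2 => f z.1 * g z.2)).
Proof.
by apply/measurable_EFinP/measurable_funM; exact: measurableT_comp.
Qed.

Lemma integrable_prodM :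
  (m1 \x m2)%E.-integrable setT (EFin \o (fun z : T1 * T2 => f z.1 * g z.2)).
Proof.
apply/(integrable12ltyP _ _ mfg).
under eq_integral => x _.
  under eq_integral do rewrite /= normrM EFinM.
  rewrite ge0_integralZl//; first over.
  by apply/measurable_EFinP; exact: measurableT_comp.
have gfin : (\int[m2]_y `|g y|%:E < +oo)%E by have /integrableP[] := ig2.
have g0 : (0 <= \int[m2]_y `|g y|%:E)%E by exact: integral_ge0.
rewrite -(@fineK _ (\int[m2]_y _)%E) ?ge0_fin_numE//.
rewrite ge0_integralZr//.
- rewrite lte_mul_pinfty ?ltry//; first exact: integral_ge0.
  by rewrite ge0_fin_numE; [have /integrableP[] := if1|exact: integral_ge0].
- by apply/measurable_EFinP; exact: measurableT_comp.
- by rewrite lee_fin fine_ge0.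
Qed.

Lemma Rintegral_prodM :
  \int[(m1 \x m2)%E]_z (f z.1 * g z.2) = (\int[m1]_x f x) * (\int[m2]_y g y).
Proof.
rewrite /Rintegral -(integral12_prod_meas1 integrable_prodM) /fubini_F/=.
under eq_integral => x _.
  under eq_integral do rewrite EFinM.
  rewrite integralZl//; first over.
rewrite -(@fineK _ (\int[m2]_y _)%E) ?(integrable_fin_num)//.
rewrite integralZr//= -[in LHS](@fineK _ (\int[m1]_y _)%E) ?integrable_fin_num//.
Qed.
End product_integral.

Section tuple_integral.
Context {R : realType}.
Let mu := @lebesgue_measure R.

(** Both claims share one induction along [tcons], because Fubini's theorem for the value requires
    the integrability of the product over the tail. *)
Lemma tuple_integral_prod n (phi : 'I_n -> R -> R) :
  (forall l, mu.-integrable setT (EFin \o phi l)) ->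
  (lebesgue_tuple n).-integrable setT
    (EFin \o (fun x : n.-tuple R => \prod_l phi l (tnth x l))) /\
  \int[lebesgue_tuple n]_x (\prod_l phi l (tnth x l)) =
    \prod_l \int[mu]_s phi l s.
Proof.
elim: n phi => [|n IH] phi iphi.
  have e : (fun x : 0.-tuple R => \prod_l phi l (tnth x l)) = cst 1.
    by apply/funext => x; rewrite big_ord0.
  rewrite e big_ord0; split.
    apply/integrableP; split; first exact/measurable_EFinP.
    by rewrite integral_dirac//= diracT ?mul1e normr1 ltry.
  by rewrite /Rintegral integral_dirac//= indicT mul1r.
have [iP eP] := IH (fun l => phi (lift ord0 l)) (fun l => iphi _).
set P := fun x : n.-tuple R => _ in iP eP.
have mphi : measurable_fun setT (fun x : n.+1.-tuple R => \prod_l phi l (tnth x l)).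
  apply: measurable_prod => l _; apply: measurableT_comp; last exact: measurable_tnth.
  by apply/measurable_EFinP; exact: measurable_int (iphi l).
have e : (fun x : n.+1.-tuple R => \prod_l phi l (tnth x l)) \o @tcons R n =
    fun z => phi ord0 z.1 * P z.2.
  apply/funext => -[s x]; rewrite /= big_ord_recl tnth0; congr (_ * _).
  by apply: eq_bigr => l _; rewrite tnthS.
have iprod : (mu \x lebesgue_tuple n)%E.-integrable setT
    ((EFin \o (fun x : n.+1.-tuple R => \prod_l phi l (tnth x l))) \o @tcons R n).
  by rewrite -compA e; exact: integrable_prodM.
split.
  apply: integrable_pushforward => //.
  - exact: measurable_tcons.
  - exact/measurable_EFinP.
rewrite big_ord_recl -eP -Rintegral_prodM // /Rintegral; congr fine.
rewrite [LHS]integral_pushforward//.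
- rewrite preimage_setT; apply: eq_integral => z _.
  exact: (congr1 (fun h => (h z)%:E) e).
- exact: measurable_tcons.
- exact/measurable_EFinP.
Qed.
End tuple_integral.

(** * Bessel's inequality *)

Section real_integrable.
Context d (T : measurableType d) (R : realType).
Variable mu : {measure set T -> \bar R}.
Implicit Types f g : T -> R.

Local Notation intR f := (mu.-integrable setT (EFin \o f)).

Lemma EFin_Rintegral f : intR f -> (\int[mu]_x (f x)%:E)%E = (\int[mu]_x f x)%:E.
Proof. by move=> fi; rewrite fineK// integrable_fin_num. Qed.

Lemma integrableRZ k f : intR f -> intR (fun x => k * f x).
Proof. by move=> /(integrableZl measurableT k); exact: eq_integrable. Qed.

Lemma integrableRD f g : intR f -> intR g -> intR (fun x => f x + g x).
Proof. by move=> fi /(integrableD measurableT fi); exact: eq_integrable. Qed.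

Lemma integrableRB f g : intR f -> intR g -> intR (fun x => f x - g x).
Proof.
by move=> fi /(integrableB measurableT fi); exact: eq_integrable.
Qed.

Lemma integrableR_sum (I : Type) (s : seq I) (F : I -> T -> R) :
  (forall i, intR (F i)) -> intR (fun x => \sum_(i <- s) F i x).
Proof.
move=> Fi; have := @integrable_sum _ _ _ mu _ measurableT I s predT
  (fun i => EFin \o F i) (fun i _ => Fi i).
by apply: eq_integrable => // x _; rewrite /= sumEFin.
Qed.

Lemma Rintegral_sum (I : Type) (s : seq I) (F : I -> T -> R) :
  (forall i, intR (F i)) ->
  \int[mu]_x \sum_(i <- s) F i x = \sum_(i <- s) \int[mu]_x F i x.
Proof.
move=> Fi; elim: s => [|i s IH].
  under eq_Rintegral do rewrite big_nil.
  by rewrite big_nil Rintegral_cst// mul0r.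
under eq_Rintegral do rewrite big_cons.
by rewrite big_cons RintegralD ?IH//; exact: integrableR_sum.
Qed.

Lemma integrable_mul_sqr f g : measurable_fun setT f -> measurable_fun setT g ->
  intR (fun x => f x ^+ 2) -> intR (fun x => g x ^+ 2) -> intR (fun x => f x * g x).
Proof.
move=> mf mg f2 g2; apply: (le_integrable _ _ _ (integrableRD f2 g2)) => //.
  by apply/measurable_EFinP/measurable_funM.
move=> x _ /=; rewrite lee_fin normrM [leRHS]ger0_norm ?addr_ge0 ?sqr_ge0//.
rewrite -(real_normK (num_real (f x))) -(real_normK (num_real (g x))).
have : 0 <= (`|f x| - `|g x|) ^+ 2 by exact: sqr_ge0.
have : 0 <= `|f x| ^+ 2 by exact: sqr_ge0.
have : 0 <= `|g x| ^+ 2 by exact: sqr_ge0.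
lra.
Qed.

(** Induction on [s] for all [p] at once: removing from [p] its projection [c * Phi a] lowers the
    squared norm by [c ^+ 2] and leaves the coefficients against the other [Phi b] unchanged. *)
Lemma bessel (I : eqType) (Phi : I -> T -> R) (s : seq I) (p : T -> R) :
  (forall a, measurable_fun setT (Phi a)) ->
  (forall a b, intR (fun x => Phi a x * Phi b x)) ->
  (forall a b, \int[mu]_x (Phi a x * Phi b x) = (a == b)%:R) ->
  uniq s -> measurable_fun setT p -> intR (fun x => p x ^+ 2) ->
  \sum_(a <- s) (\int[mu]_x (p x * Phi a x)) ^+ 2 <= \int[mu]_x (p x ^+ 2).
Proof.
move=> mPhi iPhi orth; elim: s p => [|a s IH] p.
  by move=> _ _ _; rewrite big_nil Rintegral_ge0// => x _; rewrite sqr_ge0.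
move=> /= /andP[nas us] mp ip.
have iPhi2 b : intR (fun x => Phi b x ^+ 2).
  by apply: eq_integrable (iPhi b b) => // x _; rewrite /= expr2.
have ipPhi b : intR (fun x => p x * Phi b x) by exact: integrable_mul_sqr.
set c := \int[mu]_x (p x * Phi a x).
pose q x := p x - c * Phi a x.
have mq : measurable_fun setT q.
  by apply: measurable_funB => //; exact: measurable_funM.
have q2 : (fun x => q x ^+ 2) =
    (fun x => (p x ^+ 2 - (2 * c) * (p x * Phi a x)) + c ^+ 2 * (Phi a x * Phi a x)).
  by apply/funext => x; rewrite /q; ring.
have i1 : intR (fun x => p x ^+ 2 - (2 * c) * (p x * Phi a x)).
  by apply: integrableRB => //; exact: integrableRZ.
have iq : intR (fun x => q x ^+ 2).
  by rewrite q2; apply: integrableRD => //; exact: integrableRZ.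
have eq2 : \int[mu]_x (q x ^+ 2) = \int[mu]_x (p x ^+ 2) - c ^+ 2.
  rewrite q2 RintegralD//; last exact: integrableRZ.
  rewrite RintegralB//; last exact: integrableRZ.
  by rewrite !RintegralZl// orth eqxx mulr1 -/c; ring.
rewrite big_cons -lerBrDl -eq2 (le_trans _ (IH q us mq iq))//.
rewrite big_seq [leRHS]big_seq ler_sum// => b bs.
have -> // : \int[mu]_x (p x * Phi b x) = \int[mu]_x (q x * Phi b x).
have -> : (fun x => q x * Phi b x) = (fun x => p x * Phi b x - c * (Phi a x * Phi b x)).
  by apply/funext => x; rewrite /q; ring.
rewrite RintegralB//; last exact: integrableRZ.
rewrite RintegralZl// orth (_ : a == b = false) ?mulr0 ?subr0//.
by apply: contraNF nas => /eqP ->.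
Qed.

Lemma poweR2 (x : \bar R) : (0 <= x)%E -> (x `^ 2 = x ^+ 2)%E.
Proof.
case: x => [r|_|//].
- by rewrite lee_fin poweR_EFin => r0; rewrite powR_mulrn// EFin_expe.
- by rewrite poweRyr// expe2 mulyy.
Qed.

Lemma normL2_sqr (f : T -> R[i]) :
  (normL2 mu f ^+ 2 = \int[mu]_x (normc (f x) ^+ 2)%:E)%E.
Proof.
rewrite /normL2 -poweR2 ?Lnorm_ge0// poweR_Lnorm//.
apply: eq_integral => x _; rewrite poweR_EFin/= powR_mulrn//.
by rewrite real_normK// num_real.
Qed.

Lemma normc_sqr (z : R[i]) : normc z ^+ 2 = complex.Re z ^+ 2 + complex.Im z ^+ 2.
Proof. by case: z => a b /=; rewrite sqr_sqrtr// addr_ge0// sqr_ge0. Qed.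

Lemma normc_ge0 (z : R[i]) : 0 <= normc z.
Proof. by case: z => a b; exact: sqrtr_ge0. Qed.

Lemma inL2_integrable (f : T -> R[i]) : inL2 mu f -> intR (fun x => normc (f x) ^+ 2).
Proof.
case=> mRe mIm fin; apply/integrableP; split.
  apply/measurable_EFinP; under eq_fun do rewrite normc_sqr.
  by apply: measurable_funD; exact: measurable_funX.
under eq_integral do rewrite /= ger0_norm ?sqr_ge0//.
have n0 : (0 <= normL2 mu f)%E by exact: Lnorm_ge0.
by rewrite -normL2_sqr expe2 lte_mul_pinfty// ge0_fin_numE.
Qed.

(** As the [Phi a] are real, the real and imaginary parts of the coefficients of [f] are the
    coefficients of [Re f] and [Im f], and the real inequality applies to each. *)
Lemma bessel_complex (I : eqType) (Phi : I -> T -> R) (s : seq I) (f : T -> R[i]) :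
  (forall a, measurable_fun setT (Phi a)) ->
  (forall a b, intR (fun x => Phi a x * Phi b x)) ->
  (forall a b, \int[mu]_x (Phi a x * Phi b x) = (a == b)%:R) ->
  uniq s -> inL2 mu f ->
  ((\sum_(a <- s) normc (Cintegral mu (fun x => f x * (Phi a x)%:C%C)) ^+ 2)%:E
    <= normL2 mu f ^+ 2)%E.
Proof.
move=> mPhi iPhi orth us f2; have [mRe mIm _] := f2.
have fi := inL2_integrable f2.
rewrite normL2_sqr EFin_Rintegral// lee_fin.
have iRe : intR (fun x => complex.Re (f x) ^+ 2).
  apply: (le_integrable _ _ _ fi) => //.
    by apply/measurable_EFinP; exact: measurable_funX.
  by move=> x _ /=; rewrite lee_fin !ger0_norm ?sqr_ge0// normc_sqr lerDl sqr_ge0.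
have iIm : intR (fun x => complex.Im (f x) ^+ 2).
  apply: (le_integrable _ _ _ fi) => //.
    by apply/measurable_EFinP; exact: measurable_funX.
  by move=> x _ /=; rewrite lee_fin !ger0_norm ?sqr_ge0// normc_sqr lerDr sqr_ge0.
under [leRHS]eq_Rintegral do rewrite normc_sqr.
rewrite RintegralD//.
under eq_bigr do rewrite normc_sqr.
rewrite big_split lerD//=.
- under eq_bigr => a _.
    rewrite (@eq_Rintegral _ _ _ _ _ (fun x => complex.Re (f x) * Phi a x)); last first.
      by move=> x _ /=; case: (f x) => u v /=; rewrite mulr0 subr0.
    over.
  exact: bessel.
- under eq_bigr => a _.
    rewrite (@eq_Rintegral _ _ _ _ _ (fun x => complex.Im (f x) * Phi a x)); last first.
      by move=> x _ /=; case: (f x) => u v /=; rewrite mulr0 add0r.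
    over.
  exact: bessel.
Qed.

End real_integrable.

(** * Regularized weights *)

Section ge0_le_integral.
Local Open Scope ereal_scope.
Context d (T : measurableType d) (R : realType).
Variable mu : {measure set T -> \bar R}.

(** The integral of a nonnegative function is a supremum over the simple functions below it, hence
    monotone for arbitrary functions. This is what allows integrands built from [u x t] to be
    compared in the variable [t]. *)
Lemma ge0_le_integral_nonmeasurable (D : set T) (f g : T -> \bar R) :
  (forall x, D x -> 0 <= f x <= g x) ->
  \int[mu]_(x in D) f x <= \int[mu]_(x in D) g x.
Proof.
move=> fg; rewrite [leLHS]integral_mkcond [leRHS]integral_mkcond.
have fg' x : 0 <= (f \_ D) x <= (g \_ D) x.
  by rewrite !patchE; case: ifPn => [/set_mem /fg//|_]; rewrite lexx.
rewrite !ge0_integralTE//.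
- apply: ge_ereal_sup => _ [h hf <-]; apply: ereal_sup_ubound; exists h => // x /=.
  by rewrite (le_trans (hf x))//; case/andP: (fg' x).
- by move=> x; have /andP[/le_trans] := fg' x; exact.
- by move=> x; have /andP[] := fg' x.
Qed.

End ge0_le_integral.

Section weight.
Context {R : realType}.
Let mu : {measure set _ -> \bar R} := @lebesgue_measure R.
Variables (delta e : R).
Hypotheses (delta01 : 0 <= delta < 1) (e0 : 0 < e).

(* Increases to [|s| ^ -delta] as [e] decreases to 0. Its integral over
   [-1/2, 1/2] is bounded uniformly in [e], because the derivative of
   [s * reg_weight s] is at least [(1 - delta) * reg_weight s]. *)
Definition reg_weight (s : R) : R := (s ^+ 2 + e) `^ (- (delta / 2)).

Let arg_gt0 (s : R) : 0 < s ^+ 2 + e.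
Proof. by rewrite ltr_wpDl// sqr_ge0. Qed.

Lemma reg_weight_ge0 s : 0 <= reg_weight s.
Proof. exact: powR_ge0. Qed.

Lemma is_derive_reg_weight (s : R) :
  is_derive s 1 reg_weight (- delta * s / (s ^+ 2 + e) * reg_weight s).
Proof.
have dg : is_derive s 1 (fun s : R => s ^+ 2 + e) (2 * s).
  by apply: is_derive_eq; rewrite /GRing.scale/= ?expr1 ?mulr1; ring.
have := @is_derive1_comp R (fun y => y `^ (- (delta / 2))) (fun s : R => s ^+ 2 + e) s _ _
  (is_derive1_powR (- (delta / 2)) (arg_gt0 s)) dg.
move=> /is_derive_eq; apply.
have a0 : s ^+ 2 + e != 0 by rewrite gt_eqF.
rewrite powRD; last by rewrite a0 implybT.
rewrite powR_inv1 ?ltW// /reg_weight; field.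
by rewrite a0.
Qed.

Lemma continuous_reg_weight : continuous reg_weight.
Proof. exact: is_derive_continuous is_derive_reg_weight. Qed.

Lemma powRN_half_anti (x y : R) : 0 < x -> x <= y ->
  y `^ (- (delta / 2)) <= x `^ (- (delta / 2)).
Proof.
have d0 : 0 <= delta by case/andP: delta01.
move=> x0 xy; have y0 := lt_le_trans x0 xy.
rewrite !powRN lef_pV2 ?posrE ?powR_gt0//.
by apply: ge0_ler_powR; rewrite ?nnegrE ?divr_ge0 ?(ltW x0) ?(ltW y0).
Qed.

(** The left side is at most [4^(delta / 2) <= 4^(1/2)]. *)
Lemma powRN_half_le2 (x : R) : 4^-1 <= x -> x `^ (- (delta / 2)) <= 2.
Proof.
have [d0 d1] := andP delta01.
move=> x4; have q0 : 0 < 4^-1 :> R by rewrite invr_gt0.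
apply: (le_trans (powRN_half_anti q0 x4)).
rewrite -powR_inv1// -powRrM mulN1r opprK.
apply: (@le_trans _ _ (4 `^ 2^-1)); first by apply: ler_powR; lra.
by rewrite powR12_sqrt// (_ : 4 = 2 ^+ 2) ?sqrtr_sqr ?ger0_norm//; lra.
Qed.

Lemma reg_weight_le s : reg_weight s <= e `^ (- (delta / 2)).
Proof.
by apply: powRN_half_anti => //; rewrite lerDr sqr_ge0.
Qed.

Lemma integral_reg_weight_le :
  (\int[mu]_(s in `[(- 2^-1)%R, (2^-1)%R]) (reg_weight s)%:E <= (2 / (1 - delta))%:E)%E.
Proof.
have [d0 d1] := andP delta01; have d1' : 0 < 1 - delta by rewrite subr_gt0.
pose F s := s * reg_weight s.
pose f s := reg_weight s + s * (- delta * s / (s ^+ 2 + e) * reg_weight s).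
have dF (s : R) : is_derive s 1 F (f s).
  have dw := is_derive_reg_weight s.
  by apply: is_derive_eq; rewrite /f /GRing.scale/= mulr1 addrC.
have cf : continuous f.
  move=> x; apply: cvgD; first exact: continuous_reg_weight.
  apply: cvgM => //; apply: cvgM; last exact: continuous_reg_weight.
  apply: cvgM; first by apply: cvgM => //; exact: cvg_cst.
  apply: cvgV; first by rewrite gt_eqF.
  by apply: cvgD; [exact: exprn_continuous|exact: cvg_cst].
have le_f s : (1 - delta) * reg_weight s <= f s.
  rewrite /f; set w := reg_weight s; have w0 : 0 <= w by exact: reg_weight_ge0.
  have -> : s * (- delta * s / (s ^+ 2 + e) * w) =
    - (delta * (s ^+ 2 / (s ^+ 2 + e)) * w) by ring.
  have : s ^+ 2 / (s ^+ 2 + e) <= 1 by rewrite ler_pdivrMr// mul1r lerDl ltW.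
  move=> h; have := ler_wpM2r w0 (ler_wpM2l d0 h); lra.
have m1 (g : R -> R) D : continuous g -> measurable_fun D (EFin \o g).
  move=> cg; apply/measurable_EFinP; apply: measurable_funTS.
  exact: continuous_measurable_fun.
have ab : - 2^-1 < 2^-1 :> R by lra.
have h := integral_is_derive ab dF cf.
apply: (@le_trans _ _ (\int[mu]_(s in `[(- 2^-1)%R, (2^-1)%R])
    ((1 - delta)^-1%:E * (f s)%:E))%E).
  apply: ge0_le_integral_nonmeasurable => s _; rewrite !lee_fin reg_weight_ge0/=.
  by rewrite ler_pdivlMl.
rewrite ge0_integralZl//=; first last.
- by rewrite lee_fin invr_ge0 ltW.
- by move=> s _; rewrite lee_fin (le_trans _ (le_f s))// mulr_ge0 ?reg_weight_ge0// ltW.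
- exact: m1.
rewrite h -EFinM lee_fin mulrC ler_wpM2r ?invr_ge0 ?(ltW d1')//.
(* [F] is odd, so the increment is [2 F(1/2)]. *)
have -> : F 2^-1 - F (- 2^-1) = reg_weight 2^-1.
  by rewrite /F /reg_weight sqrrN; field.
apply: powRN_half_le2; rewrite (_ : 4^-1 = 2^-1 ^+ 2) ?lerDl ?(ltW e0) //; by field.
Qed.

Definition loc_weight (s : R) : R := if `|s| <= 2^-1 then reg_weight s else 0.

Lemma loc_weight_patch : loc_weight = reg_weight \_ `[- 2^-1, 2^-1].
Proof.
apply/funext => s; rewrite patchE /loc_weight mem_setE in_itv/= -ler_norml.
by case: ifP.
Qed.

Lemma loc_weight_ge0 s : 0 <= loc_weight s.
Proof. by rewrite /loc_weight; case: ifP => // _; exact: reg_weight_ge0. Qed.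

Lemma loc_weight_le s : loc_weight s <= e `^ (- (delta / 2)).
Proof. by rewrite /loc_weight; case: ifP => _; [exact: reg_weight_le|exact: powR_ge0]. Qed.

Lemma measurable_loc_weight : measurable_fun setT loc_weight.
Proof.
rewrite loc_weight_patch; apply/(measurable_restrictT _ _).1 => //.
by apply: measurable_funTS; apply: continuous_measurable_fun; exact: continuous_reg_weight.
Qed.

Lemma integral_loc_weight_le :
  mu.-integrable setT (EFin \o loc_weight) /\ \int[mu]_s loc_weight s <= 2 / (1 - delta).
Proof.
have h : (\int[mu]_s (loc_weight s)%:E <= (2 / (1 - delta))%:E)%E.
  rewrite (le_trans _ integral_reg_weight_le)// [leRHS]integral_mkcond.
  rewrite le_eqVlt; apply/orP; left; apply/eqP.
  by apply: eq_integral => s _; rewrite loc_weight_patch restrict_EFin.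
have li : mu.-integrable setT (EFin \o loc_weight).
  apply/integrableP; split; first by apply/measurable_EFinP; exact: measurable_loc_weight.
  under eq_integral do rewrite /= ger0_norm ?loc_weight_ge0//.
  exact: le_lt_trans h (ltry _).
by split=> //; rewrite -lee_fin -EFin_Rintegral.
Qed.

Lemma integrable_hermite_loc a b :
  mu.-integrable setT (EFin \o (fun s => hermite a s * hermite b s * loc_weight s)).
Proof.
apply: (le_integrable _ _ _
  (integrableRZ (e `^ (- (delta / 2))) (integrable_hermiteM a b))) => //.
  apply/measurable_EFinP/measurable_funM; last exact: measurable_loc_weight.
  by apply: measurable_funM; apply: continuous_measurable_fun; exact: continuous_hermite.
move=> s _ /=; rewrite lee_fin normrM mulrC [leRHS]normrM ler_wpM2r//.
by rewrite !ger0_norm ?powR_ge0 ?loc_weight_ge0// loc_weight_le.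
Qed.

Definition hermite_bound (m : nat) : R := Num.sqrt (8 / Num.sqrt m.+1%:R).

Lemma hermite_le_bound m s : `|s| <= 2^-1 -> `|hermite m s| <= hermite_bound m.
Proof.
move=> s2; rewrite -sqrtr_sqr ler_wsqrtr// hermite_local_bound//.
rewrite -(real_normK (num_real s)) (_ : 4^-1 = 2^-1 ^+ 2); last by field.
by rewrite ler_sqr ?nnegrE.
Qed.

Lemma integral_hermite_loc_le a b :
  `|\int[mu]_s (hermite a s * hermite b s * loc_weight s)|
    <= hermite_bound a * hermite_bound b * (2 / (1 - delta)).
Proof.
have [li lle] := integral_loc_weight_le.
have r0 : 0 <= hermite_bound a * hermite_bound b by rewrite mulr_ge0 ?sqrtr_ge0.
apply: le_trans (ler_wpM2l r0 lle).
rewrite -RintegralZl//.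
apply: (le_trans (le_normr_Rintegral measurableT (integrable_hermite_loc a b))).
apply: le_Rintegral => //.
- apply: eq_integrable (integrable_abse (integrable_hermite_loc a b)) => //.
- exact: integrableRZ.
- move=> s _; rewrite normrM (normrM (hermite a s)).
  rewrite (ger0_norm (loc_weight_ge0 s)) /loc_weight.
  case: ifP => [s2|]; last by rewrite !mulr0.
  by rewrite ler_wpM2r ?reg_weight_ge0// ler_pM// hermite_le_bound.
Qed.

(** The power splits into two equal factors of exponent [- (delta / 2)]. On the square one factor is
    compared with [s ^+ 2 + e] and the other with [t ^+ 2 + e]; off it the base is at least 1/4, so
    each factor is at most 2, whence the 4. *)
Lemma loc_weight_mul_ge s t :
  (s ^+ 2 + t ^+ 2 + 2 * e) `^ (- delta) <= 4 + loc_weight s * loc_weight t.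
Proof.
have X0 : 0 < s ^+ 2 + t ^+ 2 + 2 * e by rewrite ltr_wpDl ?addr_ge0 ?sqr_ge0 ?mulr_gt0.
have hs : s ^+ 2 + e <= s ^+ 2 + t ^+ 2 + 2 * e by have := e0; have := sqr_ge0 t; lra.
have ht : t ^+ 2 + e <= s ^+ 2 + t ^+ 2 + 2 * e by have := e0; have := sqr_ge0 s; lra.
rewrite (_ : - delta = - (delta / 2) + - (delta / 2)); last by field.
rewrite powRD ?(gt_eqF X0) ?implybT//.
set Y := _ `^ _; have Y0 : 0 <= Y by exact: powR_ge0.
have s0 := sqr_ge0 s; have t0 := sqr_ge0 t.
have far : 4^-1 <= s ^+ 2 + t ^+ 2 -> Y * Y <= 4 + loc_weight s * loc_weight t.
  move=> st; have Y2 : Y <= 2.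
    by apply: powRN_half_le2; rewrite (le_trans st)// lerDl mulr_ge0 // ltW.
  rewrite (@le_trans _ _ 4)//; first by nra.
  by rewrite lerDl mulr_ge0 ?loc_weight_ge0.
have sq (x : R) : 2^-1 < `|x| -> 4^-1 <= x ^+ 2.
  by move=> x2; rewrite -(real_normK (num_real x)); nra.
have [s2|/sq s2] := leP `|s| 2^-1; last by apply: far; lra.
have [t2|/sq t2] := leP `|t| 2^-1; last by apply: far; lra.
rewrite /loc_weight s2 t2 ler_wpDl// ler_pM//.
- by apply: powRN_half_anti => //; exact: hs.
- by apply: powRN_half_anti => //; exact: ht.
Qed.

End weight.

(** * A Schur test *)

Section schur.
Context {R : realType}.

(** With [x = sqrt n] and [y = sqrt(n + 1)], the step [1 / y <= 2 (y - x)] follows from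
    [y^2 = x^2 + 1] and [(y - x)^2 >= 0]. *)
Lemma sum_invsqrt_le n : \sum_(b < n) (Num.sqrt b.+1%:R)^-1 <= 2 * Num.sqrt n%:R :> R.
Proof.
elim: n => [|n IH]; first by rewrite big_ord0 sqrtr0 mulr0.
rewrite big_ord_recr /= (le_trans (lerD IH (lexx _)))//.
set x := Num.sqrt n%:R; set y := Num.sqrt n.+1%:R.
have x0 : 0 <= x by exact: sqrtr_ge0.
have y0 : 0 < y by rewrite sqrtr_gt0.
have xy : y ^+ 2 = x ^+ 2 + 1 by rewrite !sqr_sqrtr// natr1.
have : y^-1 * y = 1 by rewrite mulVf// gt_eqF.
rewrite -(ler_pM2r y0) mulrDl => ->.
have : 0 <= (y - x) ^+ 2 by exact: sqr_ge0.
nra.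
Qed.

(** A discrete Beta integral, hence bounded uniformly in [S]. One writes
    [1 / (x y) = (1 / x + 1 / y) / (x + y)] and uses [x + y >= sqrt(x^2 + y^2) >= sqrt(S + 1)]; each
    of the two remaining sums is at most [2 sqrt(S + 1)]. *)
Lemma sum_invsqrtM_le S :
  \sum_(b < S.+1) (Num.sqrt b.+1%:R)^-1 * (Num.sqrt (S - b)%N.+1%:R)^-1 <= 4 :> R.
Proof.
pose t : R := Num.sqrt S.+1%:R.
have t0 : 0 < t by rewrite sqrtr_gt0.
apply: (@le_trans _ _ (\sum_(b < S.+1)
    ((Num.sqrt b.+1%:R)^-1 + (Num.sqrt (S - b)%N.+1%:R)^-1) / t)).
  apply: ler_sum => b _.
  set x := Num.sqrt b.+1%:R; set y := Num.sqrt _.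
  have x0 : 0 < x by rewrite sqrtr_gt0.
  have y0 : 0 < y by rewrite sqrtr_gt0.
  have txy : t <= x + y.
    rewrite -ler_sqr ?nnegrE ?addr_ge0 ?(ltW t0) ?(ltW x0) ?(ltW y0)//.
    rewrite sqrrD !sqr_sqrtr// (@le_trans _ _ (b.+1%:R + (S - b)%N.+1%:R))//.
      by rewrite -natrD ler_nat addnS addSn subnKC// -ltnS.
    by rewrite addrAC lerDl mulrn_wge0// mulr_ge0 ?ltW.
  rewrite ler_pdivlMr// -invfM.
  have -> : x^-1 + y^-1 = (x * y)^-1 * (x + y) by field; rewrite !gt_eqF.
  by rewrite ler_pM2l// invr_gt0 mulr_gt0.
rewrite -mulr_suml big_split/= ler_pdivrMr//.
have -> : \sum_(b < S.+1) (Num.sqrt (S - b)%N.+1%:R)^-1 =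
    \sum_(b < S.+1) (Num.sqrt b.+1%:R)^-1 :> R.
  by rewrite [RHS](reindex_inj rev_ord_inj); apply: eq_bigr => b _; rewrite /= subSS.
by have := sum_invsqrt_le S.+1; rewrite -/t; lra.
Qed.

Lemma sum_hermite_bound_le S :
  \sum_(b <- iota 0 S.+1) (hermite_bound b * hermite_bound (S - b)%N) ^+ 2 <= 256 :> R.
Proof.
(* The 64 is the square of the constant 8 in [hermite_bound], the 4 is the bound of
   [sum_invsqrtM_le]. *)
have -> : 256 = 64 * 4 :> R by ring.
rewrite -[iota _ _]/(index_iota 0 S.+1) big_mkord.
apply: le_trans (ler_wpM2l _ (sum_invsqrtM_le S)) => //.
rewrite mulr_sumr ler_sum// => b _.
rewrite exprMn !sqr_sqrtr ?divr_ge0 ?sqrtr_ge0//.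
by rewrite le_eqVlt; apply/orP; left; apply/eqP; ring.
Qed.

Lemma ler_sum_uniq_sub (I : eqType) (s t : seq I) (F : I -> R) :
  uniq s -> uniq t -> {subset s <= t} -> (forall a, 0 <= F a) ->
  \sum_(a <- s) F a <= \sum_(a <- t) F a.
Proof.
move=> us ut st F0.
rewrite (perm_big (seq.filter (mem s) t)); last first.
  apply: uniq_perm => //; first exact: filter_uniq.
  by move=> x; rewrite mem_filter /=; apply/idP/andP => [xs|[]//]; split=> //; exact: st.
by rewrite big_filter big_mkcond ler_sum// => a _; case: ifP.
Qed.

Variables (n : nat) (i j : 'I_n).
Hypothesis ij : i != j.

Definition eq_off (a b : n.-tuple nat) : bool :=
  [forall l, (l != i) && (l != j) ==> (tnth a l == tnth b l)].

(** The pairs that survive both the time integration (equal degree) and orthonormality in the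
    coordinates other than [i] and [j]. *)
Definition schur_rel (a b : n.-tuple nat) : bool :=
  eq_off a b && (tnth a i + tnth a j == tnth b i + tnth b j)%N.

Lemma eq_off_sym a b : eq_off a b = eq_off b a.
Proof. by apply: eq_forallb => l; rewrite (eq_sym (tnth a l)). Qed.

Lemma schur_rel_sym a b : schur_rel a b = schur_rel b a.
Proof. by rewrite /schur_rel eq_off_sym eq_sym. Qed.

Lemma multi_abs_schur a b : multi_abs a = multi_abs b -> eq_off a b -> schur_rel a b.
Proof.
rewrite /schur_rel => + ab; rewrite ab /multi_abs.
rewrite (bigD1 i)//= (bigD1 j)//= 1?eq_sym//.
rewrite [in X in _ = X -> _](bigD1 i)//=.
rewrite [in X in _ = X -> _](bigD1 j)//= 1?eq_sym//.
rewrite (eq_bigr (tnth b)) => [|l lij]; last first.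
  by move/forallP: ab => /(_ l); rewrite lij => /eqP.
by rewrite !addnA => /addIn ->.
Qed.

Definition pair_bound (a : n.-tuple nat) : R :=
  hermite_bound (tnth a i) * hermite_bound (tnth a j).

(** For fixed [a], a related [b] is determined by its entry at [i], which lies between 0 and [S];
    its entry at [j] is [S] minus that. The sum thus injects into the one-index sum of
    [sum_hermite_bound_le]. *)
Lemma sum_pair_bound_le (s : seq (n.-tuple nat)) a : uniq s ->
  \sum_(b <- s | schur_rel a b) pair_bound b ^+ 2 <= 256.
Proof.
move=> us; set S := (tnth a i + tnth a j)%N.
pose F b : R := (hermite_bound b * hermite_bound (S - b)%N) ^+ 2.
rewrite -big_filter; set t := seq.filter _ s.
have tP b : b \in t -> schur_rel a b by rewrite mem_filter => /andP[].
rewrite big_seq (eq_bigr (fun b => F (tnth b i))); last first.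
  move=> b /tP /andP[_ /eqP ab]; rewrite /F /pair_bound.
  by rewrite (_ : S - tnth b i = tnth b j)%N// /S ab addKn.
rewrite -big_seq -(big_map (fun b => tnth b i) xpredT F).
apply: le_trans (sum_hermite_bound_le S).
apply: ler_sum_uniq_sub.
- rewrite map_inj_in_uniq ?filter_uniq// => b c /tP /andP[/forallP ab /eqP abij].
  move=> /tP /andP[/forallP ac /eqP acij] bci; apply: eq_from_tnth => l.
  have [->//|li] := eqVneq l i; have [->|lj] := eqVneq l j.
    by have := abij; rewrite acij bci => /addnI.
  by have := ab l; have := ac l; rewrite li lj/= => /eqP <- /eqP <-.
- exact: iota_uniq.
- move=> _ /mapP[b /tP /andP[_ /eqP ab] ->].
  by rewrite mem_iota /S ab/= add0n ltnS leq_addr.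
- by move=> b; rewrite sqr_ge0.
Qed.

Lemma schur_test (s : seq (n.-tuple nat)) (x : n.-tuple nat -> R) : uniq s ->
  \sum_(a <- s) \sum_(b <- s | schur_rel a b)
     (x a * x b) * (pair_bound a * pair_bound b) <= 256 * \sum_(a <- s) x a ^+ 2.
Proof.
move=> us; set m := pair_bound.
pose Q := \sum_(a <- s) \sum_(b <- s | schur_rel a b) x a ^+ 2 * m b ^+ 2.
(* By symmetry of the relation, both squares coming from AM-GM sum to the same [Q]. *)
have QE : Q = \sum_(a <- s) \sum_(b <- s | schur_rel a b) x b ^+ 2 * m a ^+ 2.
  rewrite /Q (exchange_big_dep predT)//=; apply: eq_bigr => a _.
  by apply: eq_bigl => b; rewrite schur_rel_sym.
have Qle : Q <= 256 * \sum_(a <- s) x a ^+ 2.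
  rewrite mulr_sumr ler_sum// => a _; rewrite -mulr_sumr mulrC ler_wpM2r ?sqr_ge0//.
  exact: sum_pair_bound_le.
apply: le_trans Qle.
(* AM-GM: [(x a * m b) * (x b * m a)] is at most half the sum of the squares. *)
have -> : Q = \sum_(a <- s) \sum_(b <- s | schur_rel a b)
    2^-1 * (x a ^+ 2 * m b ^+ 2 + x b ^+ 2 * m a ^+ 2).
  under [RHS]eq_bigr do rewrite -mulr_sumr big_split.
  by rewrite -mulr_sumr big_split/= -QE -/Q; field.
apply: ler_sum => a _; apply: ler_sum => b _.
by have := sqr_ge0 (x a * m b - x b * m a); nra.
Qed.

End schur.

(** * Gram matrix of the weight *)

Section hermite_tuple_integrals.
Context {R : realType} (n : nat).
Let mu : {measure set _ -> \bar R} := @lebesgue_measure R.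
Let nu := @lebesgue_tuple R n.
Implicit Types a b : n.-tuple nat.

Local Notation intR f := (nu.-integrable setT (EFin \o f)).

Lemma measurable_hermite_tuple a : measurable_fun setT (@hermite_tuple R n a).
Proof.
apply: measurable_prod => l _; apply: measurableT_comp; last exact: measurable_tnth.
by apply: continuous_measurable_fun; exact: continuous_hermite.
Qed.

Lemma hermite_tupleM a b (x : n.-tuple R) : hermite_tuple a x * hermite_tuple b x =
  \prod_(l < n) (hermite (tnth a l) (tnth x l) * hermite (tnth b l) (tnth x l)).
Proof. by rewrite big_split. Qed.

Lemma integrable_hermite_tupleM a b : intR (fun x => hermite_tuple a x * hermite_tuple b x).
Proof.
under eq_fun do rewrite hermite_tupleM.
have [] := @tuple_integral_prod R n
  (fun l s => hermite (tnth a l) s * hermite (tnth b l) s)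
  (fun l => integrable_hermiteM _ _).
by [].
Qed.

Lemma integral_hermite_tupleM a b :
  \int[nu]_x (hermite_tuple a x * hermite_tuple b x) = (a == b)%:R.
Proof.
under eq_Rintegral do rewrite hermite_tupleM.
have [_ ->] := @tuple_integral_prod R n
  (fun l s => hermite (tnth a l) s * hermite (tnth b l) s)
  (fun l => integrable_hermiteM _ _).
under eq_bigr do rewrite integral_hermiteM.
have [->|ab] := eqVneq a b; first by rewrite big1// => l _; rewrite eqxx.
have [l abl] : exists l, tnth a l != tnth b l.
  apply/existsP; apply: contraNT ab; rewrite negb_exists => /forallP h.
  by apply/eqP/eq_from_tnth => l; apply/eqP; have := h l; rewrite negbK.
by rewrite (bigD1 l)//= (negbTE abl) mul0r.
Qed.

Variables (delta e : R) (i j : 'I_n).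
Hypotheses (delta01 : 0 <= delta < 1) (e0 : 0 < e) (ij : i != j).

(* A majorant of [(x_i ^ 2 + x_j ^ 2 + 2 e) ^ -delta]: the constant 4 takes care
   of the points off the square [|x_i|, |x_j| <= 1/2], and on the square the
   variables are separated, so that integrals against Hermite functions factor. *)
Definition tuple_weight (x : n.-tuple R) : R :=
  4 + loc_weight delta e (tnth x i) * loc_weight delta e (tnth x j).

Lemma tuple_weight_ge0 x : 0 <= tuple_weight x.
Proof. by rewrite /tuple_weight addr_ge0// mulr_ge0 ?loc_weight_ge0. Qed.

Lemma tuple_weight_le x : tuple_weight x <= 4 + (e `^ (- (delta / 2))) ^+ 2.
Proof.
by rewrite /tuple_weight lerD// expr2 ler_pM ?loc_weight_ge0 ?loc_weight_le.
Qed.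

Lemma measurable_tuple_weight : measurable_fun setT tuple_weight.
Proof.
apply: measurable_funD => //; apply: measurable_funM.
- by apply: measurableT_comp; [exact: measurable_loc_weight|exact: measurable_tnth].
- by apply: measurableT_comp; [exact: measurable_loc_weight|exact: measurable_tnth].
Qed.

(** The factor in coordinate [l] of the Gram integrand for the product part of [tuple_weight]; only
    [i] and [j] carry a weight. *)
Let loc_factor a b (l : 'I_n) (s : R) : R :=
  hermite (tnth a l) s * hermite (tnth b l) s *
  (if (l != i) && (l != j) then 1 else loc_weight delta e s).

Let prod_loc_factor a b (x : n.-tuple R) : \prod_l loc_factor a b l (tnth x l) =
  hermite_tuple a x * hermite_tuple b x *
  (loc_weight delta e (tnth x i) * loc_weight delta e (tnth x j)).
Proof.
rewrite big_split /= -hermite_tupleM; congr (_ * _).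
rewrite (bigD1 i)//= (bigD1 j)//=; last by rewrite eq_sym.
by rewrite !eqxx/= andbF big1 ?mulr1// => l ->.
Qed.

Let integrable_loc_factor a b l : mu.-integrable setT (EFin \o loc_factor a b l).
Proof.
rewrite /loc_factor; case: (_ && _); last exact: integrable_hermite_loc.
apply: eq_integrable (integrable_hermiteM (tnth a l) (tnth b l)) => // s _.
by rewrite /= mulr1.
Qed.

(** The unweighted coordinates contribute Kronecker deltas, whose product is [eq_off]; the two
    weighted ones are bounded by [integral_hermite_loc_le]. *)
Let integral_prod_loc_factor a b : `|\prod_l \int[mu]_s loc_factor a b l s|
  <= (eq_off i j a b)%:R *
     ((2 / (1 - delta)) ^+ 2 * (pair_bound i j a * pair_bound i j b)).
Proof.
rewrite (bigD1 i)//= (bigD1 j)//=; last by rewrite eq_sym.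
rewrite /loc_factor !eqxx/= andbF.
have -> : \prod_(l < n | (l != i) && (l != j))
    \int[mu]_s (hermite (tnth a l) s * hermite (tnth b l) s *
      (if (l != i) && (l != j) then 1 else loc_weight delta e s)) =
    (eq_off i j a b)%:R.
  under eq_bigr => l lij.
    rewrite lij; under eq_Rintegral do rewrite mulr1.
    rewrite integral_hermiteM; over.
  rewrite /eq_off; case: forallP => [h|nh].
    by rewrite big1// => l lij; have := h l; rewrite lij /= => ->.
  have [l /andP[lij lab]] : exists l, [&& (l != i) && (l != j) & tnth a l != tnth b l].
    apply: contrapT => nex; apply: nh => l; apply/implyP => lij.
    by apply: contrapT => /negP lab; apply: nex; exists l; rewrite lij.
  by rewrite (bigD1 l)//= (negbTE lab) mul0r.
rewrite [X in `|X|]mulrA normrM normr_nat [leRHS]mulrC ler_wpM2r// normrM.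
have hi := integral_hermite_loc_le delta01 e0 (tnth a i) (tnth b i).
have hj := integral_hermite_loc_le delta01 e0 (tnth a j) (tnth b j).
apply: (le_trans (ler_pM (normr_ge0 _) (normr_ge0 _) hi hj)).
by rewrite le_eqVlt; apply/orP; left; apply/eqP; rewrite /pair_bound; ring.
Qed.

Definition gram a b : R :=
  \int[nu]_x (hermite_tuple a x * hermite_tuple b x * tuple_weight x).

Let gram_split a b x : hermite_tuple a x * hermite_tuple b x * tuple_weight x =
  4 * (hermite_tuple a x * hermite_tuple b x) + \prod_l loc_factor a b l (tnth x l).
Proof. by rewrite prod_loc_factor /tuple_weight mulrDr [X in X + _]mulrC. Qed.

Lemma integrable_gram a b :
  intR (fun x => hermite_tuple a x * hermite_tuple b x * tuple_weight x).
Proof.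
under eq_fun do rewrite gram_split.
apply: integrableRD; first by apply: integrableRZ; exact: integrable_hermite_tupleM.
by have [] := tuple_integral_prod (integrable_loc_factor a b).
Qed.

Lemma gram_le a b : `|gram a b| <= 4 * (a == b)%:R +
  (eq_off i j a b)%:R *
  ((2 / (1 - delta)) ^+ 2 * (pair_bound i j a * pair_bound i j b)).
Proof.
rewrite /gram; under eq_Rintegral do rewrite gram_split.
have [iP eP] := tuple_integral_prod (integrable_loc_factor a b).
rewrite RintegralD//; last by apply: integrableRZ; exact: integrable_hermite_tupleM.
rewrite RintegralZl//; last exact: integrable_hermite_tupleM.
rewrite eP integral_hermite_tupleM (le_trans (ler_normD _ _))// lerD//.
  by rewrite ger0_norm// mulr_ge0.
exact: integral_prod_loc_factor.
Qed.

End hermite_tuple_integrals.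

(** * Finite sums of eigenfunctions *)

Section trig_integral.
Context {R : realType}.
Let mu : {measure set _ -> \bar R} := @lebesgue_measure R.

(** The differences of the frequencies [2 k + n] are the even integers [2 (k - l)], so for [k != l]
    the primitive takes equal values at 0 and [2 pi]. *)
Lemma integral_trig (k l : nat) (P Q : R) :
  (\int[mu]_(t in `[0%R, (2 * pi)%R])
     (P * cos ((k%:R - l%:R) * (2 * t)) + Q * sin ((k%:R - l%:R) * (2 * t)))%:E
   = (2 * pi * (k == l)%:R * P)%:E)%E.
Proof.
have pi0 : 0 < 2 * pi :> R by rewrite mulr_gt0 ?pi_gt0.
have [->|kl] := eqVneq.
  under eq_integral do rewrite subrr mul0r cos0 sin0 mulr1 mulr0 addr0.
  rewrite integral_cst//= lebesgue_measure_itv/= lte_fin pi0 -EFinB -EFinM.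
  by congr EFin; rewrite subr0; ring.
set w : R := k%:R - l%:R; have w0 : w != 0 by rewrite subr_eq0 eqr_nat.
pose F t := (P * sin (w * (2 * t)) - Q * cos (w * (2 * t))) / (2 * w).
have -> : 2 * pi * false%:R * P = F (2 * pi) - F 0.
  have sn (m : nat) : sin (m%:R * (2 * (2 * pi))) = 0 :> R.
    rewrite (_ : _ * _ = 0 + (pi *+ 2) *+ (2 * m)); last first.
      by rewrite -[_ *+ (2 * m)]mulr_natr natrM; ring.
    by rewrite (periodicn (@sinD2pi R)) sin0.
  have cn (m : nat) : cos (m%:R * (2 * (2 * pi))) = 1 :> R.
    rewrite (_ : _ * _ = 0 + (pi *+ 2) *+ (2 * m)); last first.
      by rewrite -[_ *+ (2 * m)]mulr_natr natrM; ring.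
    by rewrite (periodicn (@cosD2pi R)) cos0.
  rewrite /F !mulr0 sin0 cos0 /w [(k%:R - l%:R) * (2 * (2 * pi))]mulrBl.
  by rewrite sinB cosB !sn !cn; ring.
apply: (@integral_is_derive R F) => //.
- move=> t; apply: is_derive_eq; rewrite /GRing.scale/=; field.
  by rewrite w0.
- apply: (@is_derive_continuous R _ (fun t =>
    w * 2 * (Q * cos (w * (2 * t)) - P * sin (w * (2 * t))))) => t.
  apply: is_derive_eq; rewrite /GRing.scale/=; ring.
Qed.

End trig_integral.

Section finite_sums.
Context {R : realType} (n : nat) (c : n.-tuple nat -> R[i]).
Let mu : {measure set _ -> \bar R} := @lebesgue_measure R.
Let nu := @lebesgue_tuple R n.
Implicit Types (a b : n.-tuple nat) (s : seq (n.-tuple nat)).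

Local Notation Re := complex.Re.
Local Notation Im := complex.Im.

Definition phase_coef a t : R[i] := cexpi (- ((2 * multi_abs a + n)%N%:R * t)) * c a.

Definition osc_sum s (x : n.-tuple R) t : R[i] :=
  \sum_(a <- s) phase_coef a t * (hermite_tuple a x)%:C%C.

(** [corr_cos] and [corr_sin] are the real and imaginary parts of [c a] times the conjugate of
    [c b]; [corr] is the real part of the same product for the coefficients at time [t]. *)
Definition corr_cos a b : R := Re (c a) * Re (c b) + Im (c a) * Im (c b).
Definition corr_sin a b : R := Im (c a) * Re (c b) - Re (c a) * Im (c b).

Definition corr a b t : R :=
  corr_cos a b * cos (((multi_abs a)%:R - (multi_abs b)%:R) * (2 * t)) +
  corr_sin a b * sin (((multi_abs a)%:R - (multi_abs b)%:R) * (2 * t)).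

Lemma corrE a b t : Re (phase_coef a t) * Re (phase_coef b t) +
  Im (phase_coef a t) * Im (phase_coef b t) = corr a b t.
Proof.
rewrite /corr /corr_cos /corr_sin /phase_coef /cexpi.
have -> : ((multi_abs a)%:R - (multi_abs b)%:R) * (2 * t) =
    (2 * multi_abs a + n)%N%:R * t - (2 * multi_abs b + n)%N%:R * t.
  have h m : (2 * m + n)%N%:R = 2 * m%:R + n%:R :> R by rewrite natrD natrM.
  by rewrite !h; ring.
rewrite cosB sinB; case: (c a) => p q; case: (c b) => p' q' /=.
by rewrite !cosN !sinN; ring.
Qed.

Lemma corr_cos_le a b : `|corr_cos a b| <= normc (c a) * normc (c b).
Proof.
rewrite -ler_sqr ?nnegrE ?mulr_ge0 ?normc_ge0//.
rewrite real_normK ?num_real// exprMn !normc_sqr /corr_cos.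
by have := sqr_ge0 (Re (c a) * Im (c b) - Im (c a) * Re (c b)); nra.
Qed.

Lemma Re_osc_sum s x t : Re (osc_sum s x t) =
  \sum_(a <- s) Re (phase_coef a t) * hermite_tuple a x.
Proof.
rewrite /osc_sum (big_morph (@complex.Re R) (id1 := 0) (op1 := +%R))//; last first.
  by case=> ? ? [].
by apply: eq_bigr => a _; case: (phase_coef a t) => p q /=; rewrite mulr0 subr0.
Qed.

Lemma Im_osc_sum s x t : Im (osc_sum s x t) =
  \sum_(a <- s) Im (phase_coef a t) * hermite_tuple a x.
Proof.
rewrite /osc_sum (big_morph (@complex.Im R) (id1 := 0) (op1 := +%R))//; last first.
  by case=> ? ? [].
by apply: eq_bigr => a _; case: (phase_coef a t) => p q /=; rewrite mulr0 add0r.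
Qed.

Lemma measurable_Re_osc_sum s t : measurable_fun setT (fun x => Re (osc_sum s x t)).
Proof.
under eq_fun do rewrite Re_osc_sum.
apply: measurable_sum => a; apply: measurable_funM => //.
exact: measurable_hermite_tuple.
Qed.

Lemma measurable_Im_osc_sum s t : measurable_fun setT (fun x => Im (osc_sum s x t)).
Proof.
under eq_fun do rewrite Im_osc_sum.
apply: measurable_sum => a; apply: measurable_funM => //.
exact: measurable_hermite_tuple.
Qed.

Lemma normc_osc_sum_sqr s x t : normc (osc_sum s x t) ^+ 2 =
  \sum_(a <- s) \sum_(b <- s) corr a b t * (hermite_tuple a x * hermite_tuple b x).
Proof.
rewrite normc_sqr Re_osc_sum Im_osc_sum.
rewrite !expr2 !big_distrlr -big_split; apply: eq_bigr => a _.
rewrite -big_split; apply: eq_bigr => b _ /=.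
by rewrite -corrE; ring.
Qed.

Variables (delta e : R) (i j : 'I_n).
Hypotheses (delta01 : 0 <= delta < 1) (e0 : 0 < e) (ij : i != j).
Local Notation W := (tuple_weight delta e i j).
Local Notation gram := (gram delta e i j).

Lemma integral_osc_sum s t :
  (\int[nu]_x (normc (osc_sum s x t) ^+ 2 * W x)%:E =
   (\sum_(a <- s) \sum_(b <- s) corr a b t * gram a b)%:E)%E.
Proof.
have E x : normc (osc_sum s x t) ^+ 2 * W x = \sum_(a <- s) \sum_(b <- s)
    corr a b t * (hermite_tuple a x * hermite_tuple b x * W x).
  rewrite normc_osc_sum_sqr mulr_suml; apply: eq_bigr => a _.
  by rewrite mulr_suml; apply: eq_bigr => b _; ring.
under eq_integral do rewrite E.
have i1 a b : nu.-integrable setT (EFin \o (fun x =>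
    corr a b t * (hermite_tuple a x * hermite_tuple b x * W x))).
  by apply: integrableRZ; exact: integrable_gram.
have i2 a : nu.-integrable setT (EFin \o (fun x => \sum_(b <- s)
    corr a b t * (hermite_tuple a x * hermite_tuple b x * W x))).
  exact: integrableR_sum.
rewrite EFin_Rintegral; last exact: integrableR_sum.
rewrite Rintegral_sum//; congr EFin; apply: eq_bigr => a _.
rewrite Rintegral_sum//; apply: eq_bigr => b _.
by rewrite RintegralZl//; exact: integrable_gram.
Qed.

Lemma continuous_corr a b : continuous (corr a b).
Proof.
apply: (@is_derive_continuous R _ (fun t => ((multi_abs a)%:R - (multi_abs b)%:R) * 2 *
  (corr_sin a b * cos (((multi_abs a)%:R - (multi_abs b)%:R) * (2 * t)) -
  corr_cos a b * sin (((multi_abs a)%:R - (multi_abs b)%:R) * (2 * t))))) => t.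
apply: is_derive_eq; rewrite /GRing.scale/=; ring.
Qed.

Lemma measurable_integral_osc_sum s : measurable_fun setT
  (fun t => \int[nu]_x (normc (osc_sum s x t) ^+ 2 * W x)%:E)%E.
Proof.
under eq_fun do rewrite integral_osc_sum.
apply/measurable_EFinP; apply: measurable_sum => a; apply: measurable_sum => b.
apply: measurable_funM => //; apply: continuous_measurable_fun.
exact: continuous_corr.
Qed.

Lemma integral_corr_gram s :
  (\int[mu]_(t in `[0%R, (2 * pi)%R])
     (\sum_(a <- s) \sum_(b <- s) corr a b t * gram a b)%:E
   = (\sum_(a <- s) \sum_(b <- s)
       2 * pi * (multi_abs a == multi_abs b)%:R * corr_cos a b * gram a b)%:E)%E.
Proof.
pose I : set R := `[0%R, (2 * pi)%R]%classic.
have mI : measurable (I : set (measurableTypeR R)) by exact: measurable_itv.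
have i1 a b : mu.-integrable I (fun t => (corr a b t * gram a b)%:E).
  apply: continuous_compact_integrable; first exact: segment_compact.
  apply: continuous_subspaceT => t; apply: cvgM; last exact: cvg_cst.
  exact: continuous_corr.
have i2 a : mu.-integrable I (fun t => \sum_(b <- s) (corr a b t * gram a b)%:E)%E.
  by apply: integrable_sum.
under eq_integral do rewrite -sumEFin.
under eq_integral => t _ do under eq_bigr do rewrite -sumEFin.
rewrite integral_sum// -sumEFin; apply: eq_bigr => a _.
rewrite integral_sum// -sumEFin; apply: eq_bigr => b _.
under eq_integral do rewrite mulrC EFinM.
rewrite integralZl//; last first.
  apply: continuous_compact_integrable; first exact: segment_compact.
  by apply: continuous_subspaceT => t; exact: continuous_corr.
by rewrite /corr integral_trig -EFinM mulrC.
Qed.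

(** The constant part 4 of the weight contributes only the diagonal, by orthonormality. The product
    part contributes [K] times the quadratic form of the Schur test, with constant 256. The factor
    [2 * pi] is the length of the time interval. *)
Lemma integral_integral_osc_sum_le s : uniq s ->
  (\int[mu]_(t in `[0%R, (2 * pi)%R]) \int[nu]_x (normc (osc_sum s x t) ^+ 2 * W x)%:E
   <= (2 * pi * (4 + 256 * (2 / (1 - delta)) ^+ 2) * \sum_(a <- s) normc (c a) ^+ 2)%:E)%E.
Proof.
move=> us; under eq_integral do rewrite integral_osc_sum.
rewrite integral_corr_gram lee_fin.
set K := (2 / (1 - delta)) ^+ 2; have K0 : 0 <= K by exact: sqr_ge0.
have pi0 : 0 < 2 * pi :> R by rewrite mulr_gt0 ?pi_gt0.
pose x a := normc (c a); have x0 a : 0 <= x a by exact: normc_ge0.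
apply: (@le_trans _ _ (\sum_(a <- s) \sum_(b <- s) 2 * pi *
    (4 * ((a == b)%:R * (x a * x b)) + K * ((schur_rel i j a b)%:R *
      ((x a * x b) * (pair_bound i j a * pair_bound i j b)))))).
  apply: ler_sum => a _; apply: ler_sum => b _.
  rewrite -[leLHS]mulrA -[leLHS]mulrA ler_wpM2l ?(ltW pi0)//.
  set y := x a * x b; have y0 : 0 <= y by rewrite mulr_ge0.
  set m := pair_bound i j a * pair_bound i j b.
  have m0 : 0 <= m by rewrite !mulr_ge0 ?sqrtr_ge0.
  have [ab|_] := eqVneq; last first.
    by rewrite mul0r addr_ge0//; apply: mulr_ge0 => //;
      apply: mulr_ge0 => //; apply: mulr_ge0.
  rewrite mul1r (le_trans (ler_norm _))// normrM.
  apply: (le_trans (ler_pM _ _ (corr_cos_le a b) (gram_le delta01 e0 ij a b))) => //.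
  rewrite -/K -/y -/m mulrDr lerD//.
    by rewrite mulrCA [y * _]mulrC.
  have [eab|_] := boolP (eq_off i j a b); last first.
    rewrite mul0r mulr0; apply: mulr_ge0 => //.
    by apply: mulr_ge0 => //; apply: mulr_ge0.
  (* Equal degrees and equal entries off [i], [j] force equal sums of the entries at [i] and [j]. *)
  by rewrite (multi_abs_schur ij ab eab) !mul1r mulrCA.
under eq_bigr do rewrite -mulr_sumr.
rewrite -mulr_sumr -[leRHS]mulrA ler_wpM2l ?(ltW pi0)// mulrDl.
under eq_bigr do rewrite big_split/= -!mulr_sumr.
rewrite big_split/= -!mulr_sumr lerD//.
  rewrite ler_wpM2l// big_seq [leRHS]big_seq ler_sum// => a sa.
  under eq_bigr do rewrite mulr_natl mulrb.
  rewrite -big_mkcond (big_rem a)//= eqxx big_seq_cond big1 ?addr0//.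
  by move=> b; rewrite mem_rem_uniq// inE => /andP[/andP[/negP + _]] /eqP ab; rewrite ab.
rewrite [256 * K]mulrC -[leRHS]mulrA ler_wpM2l//.
apply: (le_trans _ (schur_test i j x us)).
apply: ler_sum => a _; rewrite [leRHS]big_mkcond ler_sum// => b _.
by case: ifP => _; rewrite ?mul1r ?mul0r.
Qed.
End finite_sums.

(** * Lower limits and exhaustions *)

Section limn_einf.
Local Open Scope ereal_scope.
Context {R : realType}.
Implicit Types u v : (\bar R)^nat.

Lemma limn_einf_ereal_sup u : limn_einf u = ereal_sup (range (einfs u)).
Proof.
rewrite limn_einf_lim; apply/cvg_lim => //.
exact/ereal_nondecreasing_cvgn/nondecreasing_einfs.
Qed.

Lemma einfs_le u n : einfs u n <= u n.
Proof. by apply: ereal_inf_lbound; exists n => /=. Qed.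

Lemma limn_einf_le_bound u (B : \bar R) : (forall n, u n <= B) -> limn_einf u <= B.
Proof.
move=> uB; rewrite limn_einf_ereal_sup; apply: ge_ereal_sup => _ [n _ <-].
exact: le_trans (einfs_le u n) (uB n).
Qed.

Lemma le_limn_einf u v : (forall n, u n <= v n) -> limn_einf u <= limn_einf v.
Proof.
move=> uv; rewrite !limn_einf_ereal_sup; apply: ge_ereal_sup => _ [n _ <-].
apply: (@le_trans _ _ (einfs v n)); last by apply: ereal_sup_ubound; exists n.
apply: le_ereal_inf_tmp => _ [m /= nm <-].
by apply: le_trans (uv m); apply: ereal_inf_lbound; exists m.
Qed.

Lemma limn_einf_ge u (X : \bar R) :
  (forall eta : R, (0 < eta)%R -> \forall n \near \oo, X <= u n + eta%:E) ->
  X <= limn_einf u.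
Proof.
move=> Xu; apply/lee_addgt0Pr => eta eta0.
have [N _ uN] := Xu _ eta0.
rewrite -leeBlDr// (@le_trans _ _ (einfs u N))//.
  apply: le_ereal_inf_tmp => _ [m /= Nm <-]; rewrite EFinN leeBlDr//; exact: uN.
by rewrite limn_einf_ereal_sup; apply: ereal_sup_ubound; exists N.
Qed.

Lemma measurable_fun_limn_einf d (T : measurableType d) (D : set T)
  (f : (T -> \bar R)^nat) : measurable D -> (forall n, measurable_fun D (f n)) ->
  measurable_fun D (fun x => limn_einf (f ^~ x)).
Proof.
move=> mD mf; apply: measurableT_comp => //.
apply: measurable_fun_limn_esup => n; exact: measurableT_comp.
Qed.

End limn_einf.

Section exhaustion.
Variable I : countType.

(** The indices of code below [m]: a sequence cofinal in the net of finite sets, turning the net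
    convergence in [sumL2] into the sequential convergence that Fatou's lemma requires. *)
Definition exhaust (m : nat) : {fset I} :=
  [fset a in pmap choice.unpickle (iota 0 m)]%fset.

Lemma exhaust_totally : exhaust @ \oo --> totally.
Proof.
move=> P [A _ AP]; exists (\max_(a <- A) choice.pickle a).+1 => // m /= mA.
apply: AP => /=; apply/fsubsetP => a aA.
rewrite !inE mem_pmap; apply/mapP; exists (choice.pickle a); last first.
  by rewrite choice.pickleK.
rewrite mem_iota add0n leq0n/= (leq_trans _ mA)// ltnS.
exact: leq_bigmax_seq.
Qed.

End exhaustion.

(** * Passage to the limit *)

Section main.
Context {R : realType} (n : nat).
Let mu : {measure set _ -> \bar R} := @lebesgue_measure R.
Let nu := @lebesgue_tuple R n.

Lemma normc_sqr_le (z v : R[i]) :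
  normc z ^+ 2 <= 2 * normc v ^+ 2 + 2 * normc (z - v) ^+ 2.
Proof.
have h : normc z <= normc v + normc (z - v).
  by apply: le_trans (le_normcD _ _); rewrite addrC subrK.
have := normc_ge0 z; have := normc_ge0 v; have := normc_ge0 (z - v).
have := sqr_ge0 (normc v - normc (z - v)).
move: (normc z) (normc v) (normc (z - v)) h => a b d h; nra.
Qed.

Variables (f : n.-tuple R -> R[i]) (u : n.-tuple R -> R -> R[i]).
Hypotheses (f2 : inL2 nu f) (fu : oscillator_solution f u).
Let c := hermite_coef f.
Let v m x t := osc_sum c (exhaust (n.-tuple nat) m) x t.

Lemma cvg_exhaust_osc_sum t :
  (fun m => normL2 nu (fun x => u x t - v m x t)) @ \oo --> 0%E.
Proof.
have [_ h] := fu t.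
exact: (cvg_comp _ _ (@exhaust_totally (n.-tuple nat : countType)) h).
Qed.

Lemma measurable_normc_sqr (g : n.-tuple R -> R[i]) :
  measurable_fun setT (fun x => complex.Re (g x)) ->
  measurable_fun setT (fun x => complex.Im (g x)) ->
  measurable_fun setT (fun x => normc (g x) ^+ 2).
Proof.
move=> mRe mIm; under eq_fun do rewrite normc_sqr.
by apply: measurable_funD; exact: measurable_funX.
Qed.

Section regularized.
Variables (delta e : R) (i j : 'I_n).
Hypotheses (delta01 : 0 <= delta < 1) (e0 : 0 < e) (ij : i != j).
Local Notation W := (tuple_weight delta e i j).

Lemma integral_solution_le t :
  (\int[nu]_x (normc (u x t) ^+ 2 * W x)%:E <=
   limn_einf (fun m => 2%:E * \int[nu]_x (normc (v m x t) ^+ 2 * W x)%:E))%E.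
Proof.
(* This bound of [W] blows up as [e] tends to 0, but it only multiplies the L^2 error, which
   vanishes in the limit over [m] for fixed [e]. *)
pose M : R := 4 + (e `^ (- (delta / 2))) ^+ 2.
have M0 : 0 < M by rewrite ltr_pwDl// sqr_ge0.
have [[uRe uIm _] _] := fu t.
have mv m : measurable_fun setT (fun x => normc (v m x t) ^+ 2).
  apply: measurable_normc_sqr.
  - exact: measurable_Re_osc_sum.
  - exact: measurable_Im_osc_sum.
have muv m : measurable_fun setT (fun x => normc (u x t - v m x t) ^+ 2).
  have vRe := measurable_Re_osc_sum c (exhaust (n.-tuple nat) m) t.
  have vIm := measurable_Im_osc_sum c (exhaust (n.-tuple nat) m) t.
  apply: measurable_normc_sqr.
  - rewrite (_ : (fun x => _) = (fun x => complex.Re (u x t) - complex.Re (v m x t))).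
      exact: measurable_funB.
    by apply/funext => x; case: (u x t) => ? ?; case: (v m x t).
  - rewrite (_ : (fun x => _) = (fun x => complex.Im (u x t) - complex.Im (v m x t))).
      exact: measurable_funB.
    by apply/funext => x; case: (u x t) => ? ?; case: (v m x t).
have mW : measurable_fun setT W by exact: measurable_tuple_weight.
have W0 x : 0 <= W x by exact: tuple_weight_ge0.
have step m : (\int[nu]_x (normc (u x t) ^+ 2 * W x)%:E <=
   2%:E * (\int[nu]_x (normc (v m x t) ^+ 2 * W x)%:E) +
   (2 * M)%:E * normL2 nu (fun x => u x t - v m x t)%R ^+ 2)%E.
  have iZ (k : R) (g : n.-tuple R -> R) : 0 <= k -> measurable_fun setT g ->
      (forall x, 0 <= g x) ->
      (k%:E * \int[nu]_x (g x)%:E = \int[nu]_x (k * g x)%:E)%E.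
    move=> k0 mg g0; rewrite -ge0_integralZl//.
    - exact/measurable_EFinP.
    - by move=> x _; rewrite lee_fin.
  have mvW : measurable_fun setT (fun x => normc (v m x t) ^+ 2 * W x).
    exact: measurable_funM.
  have vW0 x : 0 <= normc (v m x t) ^+ 2 * W x by rewrite mulr_ge0 ?sqr_ge0.
  rewrite normL2_sqr !iZ ?mulr_ge0 ?(ltW M0)//; last by move=> x; exact: sqr_ge0.
  have iD (g h : n.-tuple R -> R) : (forall x, 0 <= g x) -> measurable_fun setT g ->
      (forall x, 0 <= h x) -> measurable_fun setT h ->
      (\int[nu]_x (g x)%:E + \int[nu]_x (h x)%:E = \int[nu]_x (g x + h x)%:E)%E.
    move=> g0 mg h0 mh; rewrite -ge0_integralD//.
    - by move=> x _; rewrite lee_fin.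
    - exact/measurable_EFinP.
    - by move=> x _; rewrite lee_fin.
    - exact/measurable_EFinP.
  rewrite iD; first last.
  - by apply: measurable_funM.
  - move=> x; apply: mulr_ge0; last exact: sqr_ge0.
    by apply: mulr_ge0 => //; exact: ltW.
  - by apply: measurable_funM.
  - by move=> x; rewrite mulr_ge0.
  apply: ge0_le_integral_nonmeasurable => x _.
  rewrite !lee_fin mulr_ge0 ?sqr_ge0//=.
  apply: (le_trans (ler_wpM2r (W0 x) (normc_sqr_le _ (v m x t)))).
  rewrite mulrDl -[X in X + _ <= _]mulrA lerD// [leRHS]mulrAC ler_wpM2l//.
    by rewrite mulr_ge0// sqr_ge0.
  exact: tuple_weight_le.
apply: limn_einf_ge => eta eta0.
have /fine_cvgP[fin cv] := cvg_exhaust_osc_sum t.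
have cv2 : (fun m => (2 * M) * fine (normL2 nu (fun x => u x t - v m x t)) ^+ 2)
    @ \oo --> (0 : R).
  rewrite [X in _ --> X](_ : _ = (2 * M) * (0 * 0)); last by rewrite !mulr0.
  apply: cvgM; first exact: cvg_cst.
  exact: (cvgM cv cv).
near=> m.
apply: (le_trans (step m)); rewrite leeD2l//.
have finm : normL2 nu (fun x => u x t - v m x t) \is a fin_num by near: m.
rewrite -(fineK finm) -EFin_expe -EFinM lee_fin.
by near: m; apply: (cvgr_le _ cv2).
Unshelve. all: by end_near.
Qed.

(** The bound for finite sums, doubled because of [normc_sqr_le]. It is free of [e], [i] and [j]. *)
Definition weighted_cst : R := 2 * (2 * pi * (4 + 256 * (2 / (1 - delta)) ^+ 2)).

(** Only finite sums occur, so Fatou's lemma in [t] is available, and Bessel's inequality bounds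
    their coefficients uniformly in [m]. *)
Lemma integral_limn_einf_osc_sum_le :
  (\int[mu]_(t in `[0%R, (2 * pi)%R])
     limn_einf (fun m => 2%:E * \int[nu]_x (normc (v m x t) ^+ 2 * W x)%:E)
   <= weighted_cst%:E * normL2 nu f ^+ 2)%E.
Proof.
have mI : measurable (`[0, 2 * pi] : set (measurableTypeR R)) by exact: measurable_itv.
have g0 m t : (0 <= \int[nu]_x (normc (v m x t) ^+ 2 * W x)%:E)%E.
  by apply: integral_ge0 => x _; rewrite lee_fin mulr_ge0 ?sqr_ge0 ?tuple_weight_ge0.
have mg m : measurable_fun (`[0, 2 * pi] : set (measurableTypeR R))
    (fun t => \int[nu]_x (normc (v m x t) ^+ 2 * W x)%:E)%E.
  by apply: measurable_funTS; exact: measurable_integral_osc_sum.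
apply: (le_trans (fatou _ mI _ _)).
- by move=> m; apply: measurable_funeM.
- by move=> m t _; rewrite mule_ge0.
apply: limn_einf_le_bound => m.
rewrite ge0_integralZl//.
have us : uniq (exhaust (n.-tuple nat) m) by exact: fset_uniq.
rewrite /weighted_cst [in leRHS]EFinM -muleA lee_wpmul2l//.
apply: (le_trans (integral_integral_osc_sum_le c delta01 e0 ij us)).
have K0 : 0 <= 2 * pi * (4 + 256 * (2 / (1 - delta)) ^+ 2).
  apply: mulr_ge0; first by rewrite mulr_ge0// pi_ge0.
  by rewrite addr_ge0// mulr_ge0// sqr_ge0.
rewrite EFinM lee_wpmul2l//.
apply: bessel_complex => //.
- exact: measurable_hermite_tuple.
- exact: integrable_hermite_tupleM.
- exact: integral_hermite_tupleM.
Qed.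

End regularized.

Lemma weighted_cst_gt0 delta : 0 < weighted_cst delta.
Proof.
rewrite /weighted_cst; apply: mulr_gt0 => //; apply: mulr_gt0.
  by rewrite mulr_gt0 ?pi_gt0.
by rewrite ltr_pwDl// mulr_ge0// sqr_ge0.
Qed.

(** With [e] equal to [1 / (k + 1)], the integrand is at most the lower limit in [k] of its
    regularized versions at every point. Fatou's lemma is then used in [x] for each fixed [t], where
    [u(., t)] is measurable, and in [t] for the majorants [G k]. *)
Lemma weighted_integral_le (delta : R) (i j : 'I_n) (w : n.-tuple R -> R) :
  0 <= delta < 1 -> i != j ->
  (forall x, tnth x i ^+ 2 + tnth x j ^+ 2 <= w x) ->
  (weighted_integral u w delta <= (weighted_cst delta)%:E * normL2 nu f ^+ 2)%E.
Proof.
move=> delta01 ij wij; have [d0 d1] := andP delta01.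
have mI : measurable (`[0, 2 * pi] : set (measurableTypeR R)) by exact: measurable_itv.
have e0 k : 0 < harmonic k :> R by rewrite /harmonic/= invr_gt0.
pose W k := tuple_weight delta (harmonic k) i j.
have mW k : measurable_fun setT (W k) by exact: measurable_tuple_weight.
have pointwise x t : ((normc (u x t) ^+ 2 / w x `^ delta)%:E <=
    limn_einf (fun k => (normc (u x t) ^+ 2 * W k x)%:E))%E.
  set A := normc (u x t) ^+ 2; have A0 : 0 <= A by exact: sqr_ge0.
  have w0 : 0 <= w x by rewrite (le_trans _ (wij x))// addr_ge0 ?sqr_ge0.
  apply: limn_einf_ge => eta eta0.
  (* If [w x = 0] the quotient is [A] for [delta = 0] and [0] otherwise. *)
  have [wx0|wx0] := eqVneq (w x) 0.
    apply: nearW => k; rewrite -EFinD lee_fin wx0 ler_wpDr ?(ltW eta0)// ler_wpM2l//.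
    apply: (@le_trans _ _ 1).
      by have [->|dn0] := eqVneq delta 0; rewrite ?powRr0 ?invr1// powR0// invr0.
    by rewrite ler_wpDr ?ler1n// mulr_ge0 ?loc_weight_ge0.
  have wx : 0 < w x by rewrite lt_def wx0.
  (* The shift by [2 * harmonic k] matches the [2 * e] of [loc_weight_mul_ge]; the power is
     continuous at [w x > 0]. *)
  have cv : A * (w x + 2 * harmonic k) `^ (- delta) @[k --> \oo] --> A * (w x) `^ (- delta).
    apply: cvgM; first exact: cvg_cst.
    have cpow : {for w x, continuous (fun y => y `^ (- delta))}.
      apply: differentiable_continuous; apply/derivable1_diffP.
      by have [] := is_derive1_powR (- delta) wx.
    have cvw : w x + 2 * harmonic k @[k --> \oo] --> w x.
      rewrite -[X in _ --> X]addr0 -[X in _ --> _ + X](mulr0 2).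
      apply: cvgD; first exact: cvg_cst.
      by apply: cvgM; [exact: cvg_cst|exact: cvg_harmonic].
    exact: cvg_comp cvw cpow.
  near=> k.
  rewrite -EFinD lee_fin -lerBlDr -powRN.
  apply: (@le_trans _ _ (A * (w x + 2 * harmonic k) `^ (- delta))).
    by near: k; apply: (cvgr_ge _ cv); rewrite ltrBlDr ltrDl.
  rewrite ler_wpM2l// (le_trans _ (loc_weight_mul_ge delta01 (e0 k) _ _))//.
  have X0 : 0 < tnth x i ^+ 2 + tnth x j ^+ 2 + 2 * harmonic k.
    by rewrite ltr_wpDl ?addr_ge0 ?sqr_ge0// mulr_gt0.
  have XY : tnth x i ^+ 2 + tnth x j ^+ 2 + 2 * harmonic k <= w x + 2 * harmonic k.
    by rewrite lerD2r.
  have Y0 := lt_le_trans X0 XY.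
  rewrite !powRN lef_pV2 ?posrE ?powR_gt0//.
  by apply: ge0_ler_powR; rewrite ?nnegrE ?(ltW X0) ?(ltW Y0).
(* [G k] stands in for the inner integral of [u]: it dominates that integral and is measurable in
   [t]. *)
pose G k t := (limn_einf (fun m =>
  2%:E * \int[nu]_x (normc (v m x t) ^+ 2 * W k x)%:E))%E.
have G0 k t : (0 <= G k t)%E.
  apply: (le_trans _ (integral_solution_le i j delta01 (e0 k) t)).
  by apply: integral_ge0 => x _; rewrite lee_fin mulr_ge0 ?sqr_ge0 ?tuple_weight_ge0.
have mG k : measurable_fun (`[0, 2 * pi] : set (measurableTypeR R)) (G k).
  apply: measurable_fun_limn_einf => // m; apply: measurable_funeM.
  by apply: measurable_funTS; exact: measurable_integral_osc_sum.
rewrite /weighted_integral.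
apply: (@le_trans _ _ (\int[mu]_(t in `[0%R, (2 * pi)%R])
    limn_einf (fun k => G k t))%E).
  apply: ge0_le_integral_nonmeasurable => t _.
  have h0 x : (0 <= (normc (u x t) ^+ 2 / w x `^ delta)%:E)%E.
    by rewrite lee_fin divr_ge0 ?sqr_ge0 ?powR_ge0.
  rewrite integral_ge0//=.
  apply: (@le_trans _ _ (\int[nu]_x limn_einf
      (fun k => (normc (u x t) ^+ 2 * W k x)%:E))%E).
    by apply: ge0_le_integral_nonmeasurable => x _; rewrite h0 pointwise.
  have [[uRe uIm _] _] := fu t.
  apply: (le_trans (fatou _ measurableT _ _)).
  - move=> k; apply/measurable_EFinP; apply: measurable_funM => //.
    exact: measurable_normc_sqr.
  - by move=> k x _; rewrite lee_fin mulr_ge0 ?sqr_ge0 ?tuple_weight_ge0.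
  by apply: le_limn_einf => k; exact: integral_solution_le.
apply: (le_trans (fatou _ mI mG _)) => //.
by apply: limn_einf_le_bound => k; exact: integral_limn_einf_osc_sum_le.
Unshelve. all: by end_near.
Qed.
End main.

Theorem theorem3 (R : realType) :
  (forall (n : nat) (delta : R), (2 <= n)%N -> 0 <= delta < 1 ->
     exists2 C : R, 0 < C &
       forall (f : n.-tuple R -> R[i]) (u : n.-tuple R -> R -> R[i]),
         inL2 (lebesgue_tuple n) f -> oscillator_solution f u ->
         (weighted_integral u (fun x => x`_0 ^+ 2 + x`_1 ^+ 2)%R delta
          <= C%:E * normL2 (lebesgue_tuple n) f ^+ 2)%E)
  /\
  (forall (n : nat) (delta : R) (i j k : 'I_n), (3 <= n)%N -> 0 <= delta < 1 ->
     i != j -> i != k -> j != k ->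
     exists2 C : R, 0 < C &
       forall (f : n.-tuple R -> R[i]) (u : n.-tuple R -> R -> R[i]),
         inL2 (lebesgue_tuple n) f -> oscillator_solution f u ->
         (weighted_integral u
            (fun x => tnth x i ^+ 2 + tnth x j ^+ 2 + tnth x k ^+ 2)%R delta
          <= C%:E * normL2 (lebesgue_tuple n) f ^+ 2)%E).
Proof.
split=> [n delta n2 delta01|n delta i j k _ delta01 ij _ _].
- exists (weighted_cst delta) => [|f u f2 fu]; first exact: weighted_cst_gt0.
  apply: (weighted_integral_le f2 fu (i := Ordinal (ltnW n2)) (j := Ordinal n2)) => // x.
  by rewrite !(tnth_nth 0).
- exists (weighted_cst delta) => [|f u f2 fu]; first exact: weighted_cst_gt0.
  apply: (weighted_integral_le f2 fu delta01 ij) => x.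
  by rewrite lerDl sqr_ge0.
Qed.
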